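(* For every $g\in H$ and every $\lambda>0$, as $|c|\to\infty$ the functions $R^{(c)}_\lambda g$ converge in $H^1$ to $$R^\ast_\lambda g:=-P_{1,\lambda}(A-\lambda)^{-1}g,$$ where $P_{1,\lambda}$ is the orthogonal projection of $H^1$ onto the subspace $K:=\mathrm{Ker}(B)\cap H^1=\{\varphi\in H^1: B\varphi=0\}$ with respect to the scalar product on $H^1$ given by $\langle\psi,\varphi\rangle_{1,\lambda}:=\langle\psi,\varphi\rangle_{H^1}+\lambda\langle\psi,\varphi\rangle$.
   Context: Setting. $(M,g)$ is a compact oriented $d$-dimensional Riemannian manifold without boundary, $U\in C^1(M)$ is such that $\pi(dx)=e^{-U(x)}\mathrm{vol}(dx)$ is a probability measure, $\langle f,h\rangle=\int_M fh\,d\pi$, and $v\cdot w$ denotes the Riemannian inner product of tangent vectors. $A$ is the Friedrichs extension in $L^2(M,\pi)$ of $f\mapsto\Delta f-\nabla U\cdot\nabla f$ on $C^\infty(M)$ ($\Delta$ has spectrum in $(-\infty,0]$). It is assumed that $A$ has discrete spectrum $0=\lambda_0>-\lambda_1\ge-\lambda_2\ge\dots$ with $\lambda_n\to\infty$ and a complete orthonormal basis of eigenvectors $\phi_0,\phi_1,\dots$ of $L^2(M,\pi)$, $A\phi_n=-\lambda_n\phi_n$, with $\phi_0$ spanning the constants. Sobolev spaces: $H^m=\{\varphi=\sum_{k\ge1}a_k\phi_k:\ \sum_{k\ge1}|a_k|^2\lambda_k^m<\infty\}$ and $H:=H^0$ (the orthogonal complement of the constants in $L^2(M,\pi)$). On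 $H^1$: $\langle f,h\rangle_{H^1}=\int_M\nabla f\cdot\nabla h\,d\pi$. The operator $A$ restricted to $H$ has domain $H^2$. $b$ is a $C^1$ vector field on $M$ with $\mathrm{div}(e^{-U}b)=0$ and $H^1\subset\mathrm{Dom}(b\cdot\nabla)$. $B:H^1\to H$ is the continuous extension of $f\mapsto b\cdot\nabla f$ from smooth functions; it is antisymmetric: $\langle\varphi,B\psi\rangle=-\langle\psi,B\varphi\rangle$ for $\varphi,\psi\in H^1$. For $c\in\mathbb{R}$, $A_c:=A+cB$ with domain $H^2$. For $\lambda>0$, $R^{(c)}_\lambda g:=-(A_c-\lambda)^{-1}g$, i.e. $R_\lambda^{(c)}g=-\psi_c$ where $\psi_c$ is the unique solution of $A_c\psi-\lambda\psi=g$. *)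

(* Defs.v *)
From HB Require Import structures.
From mathcomp Require Import all_boot all_order all_algebra.
From mathcomp Require Import all_classical all_reals all_analysis.

Set Implicit Arguments.
Unset Strict Implicit.
Unset Printing Implicit Defensive.

Import Order.TTheory GRing.Theory Num.Theory.
Import numFieldNormedType.Exports.

Local Open Scope classical_set_scope.
Local Open Scope ring_scope.

Section Euclidean.
Context {R : realType} {d : nat}.

Definition partial (k : 'I_d) (f : 'rV[R]_d -> R) (u : 'rV[R]_d) : R :=
  'D_(delta_mx ord0 k) f u.

(* f is of class C^n on the open set V. *)
Fixpoint Ck (n : nat) (V : set 'rV[R]_d) (f : 'rV[R]_d -> R) : Prop :=
  (forall u, V u -> {for u, continuous f}) /\
  (if n is n'.+1 then
     forall k : 'I_d,
       (forall u, V u -> derivable f u (delta_mx ord0 k)) /\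
       Ck n' V (partial k f)
   else True).

Definition Cinfty (V : set 'rV[R]_d) (f : 'rV[R]_d -> R) : Prop :=
  forall n, Ck n V f.

Definition differential_row (f : 'rV[R]_d -> R) (u : 'rV[R]_d) : 'rV[R]_d :=
  \row_k partial k f u.

End Euclidean.

Definition borel (X : ptopologicalType) := g_sigma_algebraType (@open X).

(* Determines d-dimensional Lebesgue measure on the Borel sets uniquely. *)
Definition is_lebesgue (R : realType) (d : nat)
    (mu : {measure set (borel 'rV[R]_d) -> \bar R}) : Prop :=
  forall a b : 'rV[R]_d, (forall k, a ord0 k <= b ord0 k) ->
    mu [set u | forall k, a ord0 k <= u ord0 k <= b ord0 k] =
      (\prod_k (b ord0 k - a ord0 k))%:E.

(* An oriented C^infty atlas without boundary.  The maps are total but only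
   meaningful on [dom i] and on [image i], respectively. *)
Record oriented_atlas (R : realType) (d : nat) (M : ptopologicalType) := {
  chart : Type ;
  dom : chart -> set M ;
  coord : chart -> M -> 'rV[R]_d ;
  param : chart -> 'rV[R]_d -> M ;
  chart_at : M -> chart ;
  image := fun i => coord i @` dom i ;
  transition := fun i j => coord j \o param i ;
  dom_chart_at : forall x, dom (chart_at x) x ;
  open_dom : forall i, open (dom i) ;
  open_image : forall i, open (image i) ;
  coordK : forall i x, dom i x -> param i (coord i x) = x ;
  coord_continuous : forall i x, dom i x -> {for x, continuous (coord i)} ;
  param_continuous : forall i u, image i u -> {for u, continuous (param i)} ;
  transition_smooth : forall i j (k : 'I_d),
    Cinfty (coord i @` (dom i `&` dom j))
      (fun u => transition i j u ord0 k) ;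
  transition_oriented : forall i j x, dom i x -> dom j x ->
    0 < \det ('J (transition i j) (coord i x))
}.

(* The library's Jacobian acts on row vectors by v |-> v *m 'J, hence the place
   of the transposes here and in [is_vector_field]. *)
Record riemannian (R : realType) (d : nat) (M : ptopologicalType) := {
  atlas :> oriented_atlas R d M ;
  metric : chart atlas -> 'rV[R]_d -> 'M[R]_d ;
  metric_smooth : forall i k l,
    Cinfty (image i) (fun u => metric i u k l) ;
  metric_sym : forall i u, image i u -> (metric i u)^T = metric i u ;
  metric_pos : forall i u (v : 'rV[R]_d), image i u -> v != 0 ->
    0 < (v *m metric i u *m v^T) ord0 ord0 ;
  metric_compat : forall i j x, dom i x -> dom j x ->
    let J := 'J (transition i j) (coord i x) in
    metric i (coord i x) = J *m metric j (coord j x) *m J^T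
}.

Section Geometry.
Context {R : realType} {d : nat} {M : ptopologicalType}.
Variable S : riemannian R d M.

Definition CkM (n : nat) (f : M -> R) : Prop :=
  forall i : chart S, Ck n (image i) (f \o param i).

Definition smooth (f : M -> R) : Prop := forall n, CkM n f.

(* A vector field is given by its components in each chart. *)
Definition vfield : Type := chart S -> 'rV[R]_d -> 'rV[R]_d.

Definition is_vector_field (X : vfield) : Prop :=
  forall i j x, dom i x -> dom j x ->
    X j (coord j x) = X i (coord i x) *m 'J (transition i j) (coord i x).

Definition C1_vector_field (X : vfield) : Prop :=
  is_vector_field X /\
  forall i k, Ck 1 (image i) (fun u => X i u ord0 k).

Definition vscale (f : M -> R) (X : vfield) : vfield :=
  fun i u => f (param i u) *: X i u.

Definition grad (f : M -> R) : vfield :=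
  fun i u => differential_row (f \o param i) u *m invmx (metric i u).

(* The functions below are evaluated in the chart [chart_at S x]; by the
   compatibility conditions any other chart around x gives the same value. *)
Definition dot (X Y : vfield) (x : M) : R :=
  let i := chart_at S x in let u := coord i x in
  (X i u *m metric i u *m (Y i u)^T) ord0 ord0.

Definition vol_density (i : chart S) (u : 'rV[R]_d) : R :=
  Num.sqrt (\det (metric i u)).

Definition divergence (X : vfield) (x : M) : R :=
  let i := chart_at S x in let u := coord i x in
  (vol_density i u)^-1 *
    \sum_k partial k (fun w => vol_density i w * X i w ord0 k) u.


Definition laplacian (f : M -> R) : M -> R := divergence (grad f).

Definition is_riemannian_volume
    (vol : {measure set (borel M) -> \bar R}) : Prop :=
  exists2 leb : {measure set (borel 'rV[R]_d) -> \bar R}, is_lebesgue leb &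
    forall (i : chart S) (E : set (borel M)), measurable E -> E `<=` dom i ->
      vol E =
        (\int[leb]_(u in (coord i @` E : set (borel 'rV[R]_d)))
           (vol_density i u)%:E)%E.

End Geometry.

Arguments grad {R d M} S f.

(* Elements of L^2(M, pi) are represented by functions, and equality in
   L^2(M, pi) is pi-almost everywhere equality. *)
Section Analysis.
Context {R : realType} {d : nat} {M : ptopologicalType} (S : riemannian R d M).
Variable pi : probability (borel M) R.

Definition L2 (f : M -> R) : Prop := (f : borel M -> R) \in Lfun pi 2%:E.

Definition eqL2 (f h : M -> R) : Prop :=
  ae_eq pi [set: borel M] (f : borel M -> R) h.

Definition inner (f h : M -> R) : R := \int[pi]_x (f x * h x).

Definition normL2 (f : M -> R) : R := Num.sqrt (inner f f).

Definition cvgL2 (s : nat -> M -> R) (f : M -> R) : Prop :=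
  normL2 (s n - f) @[n --> \oo] --> (0 : R).

Definition dirichlet0 (f h : M -> R) : R :=
  \int[pi]_x dot (grad S f) (grad S h) x.

(* s consists of smooth functions, converges to f in L^2 and is Cauchy for the
   Dirichlet form. *)
Definition form_approx (f : M -> R) (s : nat -> M -> R) : Prop :=
  [/\ forall n, smooth S (s n), cvgL2 s f &
      forall e : R, 0 < e -> exists N : nat, forall m n : nat,
        (N <= m)%N -> (N <= n)%N -> dirichlet0 (s m - s n) (s m - s n) < e].

Definition form_domain (f : M -> R) : Prop :=
  L2 f /\ exists s, form_approx f s.

Definition closed_form (f h : M -> R) (r : R) : Prop :=
  forall s t, form_approx f s -> form_approx h t ->
    dirichlet0 (s n) (t n) @[n --> \oo] --> r.

(* \int grad f . grad h dpi, extended by closure from smooth functions. *)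
Definition dirichlet (f h : M -> R) : R := get [set r | closed_form f h r].

Definition normH1 (f : M -> R) : R := Num.sqrt (dirichlet f f).

(* Unbounded operators are represented by their graphs. *)
Definition operator : Type := (M -> R) -> (M -> R) -> Prop.

Definition drift_laplacian (U f : M -> R) : M -> R :=
  fun x => laplacian S f x - dot (grad S U) (grad S f) x.

(* A is the Friedrichs extension of L = Delta - grad U . grad on smooth
   functions: the extension of L attached to the closure of the quadratic form
   <- L f, h> = \int grad f . grad h dpi. *)
Definition friedrichs_extension (U : M -> R) (A : operator) : Prop :=
  (forall f, smooth S f -> A f (drift_laplacian U f)) /\
  (forall f g, A f g <->
     [/\ form_domain f, L2 g &
         forall h, smooth S h -> closed_form f h (- inner g h)]).

Definition partial_sum (phi : nat -> M -> R) (a : nat -> R) (m n : nat) :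
  M -> R := fun x => \sum_(m <= k < n) a k * phi k x.

(* The eigenvalues of A are - lam n. *)
Definition eigenbasis (A : operator) (lam : nat -> R) (phi : nat -> M -> R) :
    Prop :=
  [/\ [/\ lam 0%N = 0, 0 < lam 1%N, {homo lam : m n / (m <= n)%N >-> m <= n} &
          lam n @[n --> \oo] --> +oo],
      forall n, L2 (phi n) /\ A (phi n) (fun x => - lam n * phi n x),
      forall m n, inner (phi m) (phi n) = (m == n)%:R,
      forall f, L2 f ->
        cvgL2 (partial_sum phi (fun k => inner f (phi k)) 0) f &
      exists c : R, eqL2 (phi 0%N) (cst c)].

Section Sobolev.
Variables (A : operator) (lam : nat -> R) (phi : nat -> M -> R).

Definition sobolev (m : nat) (f : M -> R) : Prop :=
  L2 f /\ exists a : nat -> R,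
    cvgL2 (partial_sum phi a 1) f /\
    cvgn (fun n : nat => \sum_(1 <= k < n) `|a k| ^+ 2 * lam k ^+ m).

Definition transport (b : vfield S) (f : M -> R) : M -> R := dot b (grad S f).

(* The domain in L^2(M, pi) of the closure of b . grad on smooth functions. *)
Definition transport_domain (b : vfield S) (f : M -> R) : Prop :=
  L2 f /\ exists (s : nat -> M -> R) (u : M -> R),
    [/\ forall n, smooth S (s n), L2 u, cvgL2 s f &
        cvgL2 (fun n => transport b (s n)) u].

(* B : H^1 -> H is the continuous linear extension of b . grad; the values of B
   outside H^1 are irrelevant. *)
Definition continuous_extension (b : vfield S) (B : (M -> R) -> (M -> R)) :
    Prop :=
  [/\ forall f, sobolev 1 f -> sobolev 0 (B f),
      forall (a : R) f h, sobolev 1 f -> sobolev 1 h ->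
        eqL2 (B (a *: f + h)) (a *: B f + B h),
      exists C : R, forall f, sobolev 1 f -> normL2 (B f) <= C * normH1 f &
      forall f, smooth S f -> inner f (cst 1) = 0 ->
        eqL2 (B f) (transport b f)].

Definition antisymmetric_on_H1 (B : (M -> R) -> (M -> R)) : Prop :=
  forall f h, sobolev 1 f -> sobolev 1 h -> inner f (B h) = - inner h (B f).

(* A_c = A + c B with domain H^2. *)
Definition perturbed (B : (M -> R) -> (M -> R)) (c : R) : operator :=
  fun f g => sobolev 2 f /\ exists2 u, A f u & eqL2 g (u + c *: B f).

(* The restriction of A to H. *)
Definition restricted : operator := fun f g => sobolev 2 f /\ A f g.

(* (T - l)^-1 g, defined up to pi-a.e. equality. *)
Definition shift_inverse (T : operator) (l : R) (g : M -> R) : M -> R :=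
  get [set psi : M -> R | T psi (g + l *: psi)].

Definition kerB (B : (M -> R) -> (M -> R)) (f : M -> R) : Prop :=
  sobolev 1 f /\ eqL2 (B f) 0.

Definition inner1 (l : R) (f h : M -> R) : R := dirichlet f h + l * inner f h.

(* Orthogonal projection onto K for the scalar product ip, defined up to
   pi-a.e. equality. *)
Definition orth_proj (ip : (M -> R) -> (M -> R) -> R) (K : (M -> R) -> Prop)
    (f : M -> R) : M -> R :=
  get [set p : M -> R | K p /\ forall h, K h -> ip (f - p) h = 0].

Definition resolvent (B : (M -> R) -> (M -> R)) (c l : R) (g : M -> R) :
  M -> R := - shift_inverse (perturbed B c) l g.

Definition resolvent_star (B : (M -> R) -> (M -> R)) (l : R) (g : M -> R) :
  M -> R := - orth_proj (inner1 l) (kerB B) (shift_inverse restricted l g).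

Definition cvgH1_at_infinity (F : R -> M -> R) (f : M -> R) : Prop :=
  [/\ forall c, sobolev 1 (F c), sobolev 1 f &
      forall e : R, 0 < e -> exists C : R, forall c : R, C < `|c| ->
        normH1 (F c - f) < e].

End Sobolev.
End Analysis.

(* Main.v *)
(* The Friedrichs hypothesis applied to constant sequences of smooth functions
   is Green's formula for the Dirichlet form, which makes the form closable.
   Its closure turns H^1 into a Hilbert space for <.,.>_{1,l}, on which beta(f,h) = <B f, h> is a bounded skew form
   <S f, h>_{1,l}.  The equation A_c psi - l psi = g reads (1 - c S) psi = psi_0
   with psi_0 = (A - l)^-1 g, and |(1 - c S)^-1| <= 1.  Write
   psi_0 = p + q with p in K = Ker S and q orthogonal to K.  Then
   (1 - c S)^-1 p = p, and q lies in the closure of the range of S, on which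
   (1 - c S)^-1 tends to 0 because (1 - c S)^-1 S w = ((1 - c S)^-1 w - w) / c. *)
Require Import Defs.
From HB Require Import structures.
From mathcomp Require Import all_boot all_order all_algebra.
From mathcomp Require Import all_classical all_reals all_analysis.
From mathcomp Require Import measurable_realfun.
From mathcomp Require Import ring lra.

Set Implicit Arguments.
Unset Strict Implicit.
Unset Printing Implicit Defensive.

Import Order.TTheory GRing.Theory Num.Theory.
Import numFieldNormedType.Exports.

Local Open Scope classical_set_scope.
Local Open Scope ring_scope.

(** * Semi-inner products on subspaces *)

(** Functions stand for classes, and [dirichlet], [shift_inverse] and [orth_proj] are choices made
    by [get]: each is usable only once an object of the required kind is known to exist, and vectors
    so selected are determined only up to null vectors. Hence the abstract results concern
    degenerate products and weak equations tested against [H]. The equation must be solved for every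
    real c, so no Neumann series is available; what survives for all c is that a skew term vanishes
    on the diagonal. H^1 occurs in two guises, by Fourier coefficients in the statement and as a
    form domain in the Hilbert space argument; the eigenbasis reconciles them and also places weak
    solutions in H^2. As for signs, pairing A psi + c B psi - l psi = g with h gives <psi, h>_{1,l}
    - c <B psi, h> = - <g, h>, so psi_0 represents the functional - <g, .>. *)

(* Elements of L^2 are functions rather than classes, so the inner product is
   degenerate and only meaningful on the subspace [H]. *)
Record semi_inner (R : realType) (V : lmodType R) (H : set V)
    (ip : V -> V -> R) : Prop := SemiInner {
  sip0 : H 0 ;
  sip_lin : forall a x y, H x -> H y -> H (a *: x + y) ;
  sipC : forall x y, H x -> H y -> ip x y = ip y x ;
  sipL : forall a x y z, H x -> H y -> H z ->
    ip (a *: x + y) z = a * ip x z + ip y z ;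
  sip_ge0 : forall x, H x -> 0 <= ip x x
}.

Definition ip_cauchy (R : realType) (V : lmodType R) (ip : V -> V -> R)
    (u : nat -> V) : Prop :=
  forall e : R, 0 < e -> exists N : nat, forall m n : nat,
    (N <= m)%N -> (N <= n)%N -> ip (u m - u n) (u m - u n) < e.

Definition ip_norm (R : realType) (V : lmodType R) (ip : V -> V -> R) (x : V)
  : R := Num.sqrt (ip x x).

Definition ip_cvg (R : realType) (V : lmodType R) (ip : V -> V -> R)
    (u : nat -> V) (x : V) : Prop :=
  ip_norm ip (u n - x) @[n --> \oo] --> (0 : R).

Definition ip_complete (R : realType) (V : lmodType R) (H : set V)
    (ip : V -> V -> R) : Prop :=
  forall u, (forall n, H (u n)) -> ip_cauchy ip u ->
    exists2 x, H x & ip_cvg ip u x.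

(** The coefficient q may vanish, since the products are degenerate; nonnegativity of an affine
    function of t then forces r = 0. *)
Lemma discriminant_le (R : realFieldType) (p r q : R) : 0 <= q ->
  (forall t, 0 <= p + 2 * t * r + t ^+ 2 * q) -> r ^+ 2 <= p * q.
Proof.
move=> q0 hq; have [q_eq0|q_neq0] := eqVneq q 0.
  rewrite q_eq0 mulr0; have [->|r0] := eqVneq r 0; first by rewrite expr0n.
  (* This t gives p + 2 t r the value -1. *)
  have := hq (- (p + 1) / (2 * r)); rewrite q_eq0 mulr0 addr0.
  have -> : p + 2 * (- (p + 1) / (2 * r)) * r = -1 by field.
  by lra.
have q_gt0 : 0 < q by rewrite lt_neqAle eq_sym q_neq0.
have := hq (- r / q).
have -> : p + 2 * (- r / q) * r + (- r / q) ^+ 2 * q = p - r ^+ 2 / q by field.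
by rewrite subr_ge0 ler_pdivrMr.
Qed.

Lemma cvg_seqP (R : realType) (u : nat -> R) (x : R) :
  u n @[n --> \oo] --> x <->
  forall e, 0 < e -> exists N, forall n, (N <= n)%N -> `|u n - x| < e.
Proof.
split=> [ux e e0|h].
  have /cvgrPdist_lt/(_ e e0) [N _ hN] := ux.
  by exists N => n Nn; rewrite distrC; exact: hN.
apply/cvgrPdist_lt => e e0; have [N hN] := h e e0.
by exists N => // n Nn; rewrite distrC; exact: hN.
Qed.

Lemma seq_lim_unique (R : realType) (u : nat -> R) (x y : R) :
  u n @[n --> \oo] --> x -> u n @[n --> \oo] --> y -> x = y.
Proof. by move=> ux uy; apply: cvg_unique ux uy; exact: Rhausdorff. Qed.

Lemma seq_lim_le (R : realType) (u : nat -> R) (x c : R) (N : nat) :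
  u n @[n --> \oo] --> x -> (forall n, (N <= n)%N -> u n <= c) -> x <= c.
Proof.
move=> /cvg_seqP ux uc; rewrite leNgt; apply/negP => cx.
have [|N' hN'] := ux (x - c); first by rewrite subr_gt0.
have := hN' _ (leq_maxr N N'); have := uc _ (leq_maxl N N').
by rewrite ltr_norml; lra.
Qed.

Lemma invn_lt (R : realType) (e : R) : 0 < e ->
  exists N, forall n, (N <= n)%N -> n.+1%:R^-1 < e.
Proof.
move=> /ltr_add_invr[N]; rewrite add0r => hN; exists N => n Nn.
by apply: le_lt_trans hN; rewrite lef_pV2 ?posrE// ler_nat.
Qed.

Section SemiInner.
Context {R : realType} {V : lmodType R} {H : set V} {ip : V -> V -> R}.
Hypothesis sp : semi_inner H ip.
Local Notation nrm := (ip_norm ip).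

Lemma sipD x y : H x -> H y -> H (x + y).
Proof. by move=> Hx Hy; rewrite -[x]scale1r; exact: (sip_lin sp). Qed.

Lemma sipZ a x : H x -> H (a *: x).
Proof.
by move=> Hx; rewrite -[_ *: _]addr0; apply: (sip_lin sp) => //; exact: sip0 sp.
Qed.

Lemma sipN x : H x -> H (- x).
Proof. by move=> Hx; rewrite -scaleN1r; exact: sipZ. Qed.

Lemma sipB x y : H x -> H y -> H (x - y).
Proof. by move=> Hx Hy; apply: sipD => //; exact: sipN. Qed.

Lemma ipDl x y z : H x -> H y -> H z -> ip (x + y) z = ip x z + ip y z.
Proof. by move=> *; rewrite -[x]scale1r (sipL sp)// mul1r scale1r. Qed.

Lemma ip0l x : H x -> ip 0 x = 0.
Proof.
move=> Hx; have H0 := sip0 sp.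
by have := ipDl H0 H0 Hx; rewrite addr0 => /eqP; rewrite -subr_eq0 opprD addNKr oppr_eq0 => /eqP.
Qed.

Lemma ipZl a x y : H x -> H y -> ip (a *: x) y = a * ip x y.
Proof.
move=> Hx Hy; have H0 := sip0 sp.
by rewrite -[_ *: _]addr0 (sipL sp)// ip0l// addr0.
Qed.

Lemma ipNl x y : H x -> H y -> ip (- x) y = - ip x y.
Proof. by move=> Hx Hy; rewrite -scaleN1r ipZl// mulN1r. Qed.

Lemma ipBl x y z : H x -> H y -> H z -> ip (x - y) z = ip x z - ip y z.
Proof. by move=> Hx Hy Hz; rewrite ipDl ?ipNl//; exact: sipN. Qed.

Lemma ipDr x y z : H x -> H y -> H z -> ip z (x + y) = ip z x + ip z y.
Proof.
move=> Hx Hy Hz; rewrite (sipC sp Hz (sipD Hx Hy)) ipDl//.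
by rewrite (sipC sp Hx Hz) (sipC sp Hy Hz).
Qed.

Lemma ipZr a x y : H x -> H y -> ip x (a *: y) = a * ip x y.
Proof.
by move=> Hx Hy; rewrite (sipC sp Hx (sipZ a Hy)) ipZl// (sipC sp Hx Hy).
Qed.

Lemma ipNr x y : H x -> H y -> ip x (- y) = - ip x y.
Proof. by move=> Hx Hy; rewrite -scaleN1r ipZr// mulN1r. Qed.

Lemma ipBr x y z : H x -> H y -> H z -> ip z (x - y) = ip z x - ip z y.
Proof. by move=> Hx Hy Hz; rewrite ipDr ?ipNr//; exact: sipN. Qed.

Lemma ip_quad t x y : H x -> H y ->
  ip (x + t *: y) (x + t *: y) = ip x x + 2 * t * ip x y + t ^+ 2 * ip y y.
Proof.
move=> Hx Hy; have Hty := sipZ t Hy; have Hs := sipD Hx Hty.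
rewrite ipDl// !ipDr// !ipZl// !ipZr// (sipC sp Hy Hx); ring.
Qed.

Lemma nrm_ge0 x : 0 <= nrm x. Proof. exact: sqrtr_ge0. Qed.

Lemma nrm_sqr x : H x -> nrm x ^+ 2 = ip x x.
Proof. by move=> Hx; rewrite sqr_sqrtr// (sip_ge0 sp). Qed.

Lemma ip_sqr_le x y : H x -> H y -> ip x y ^+ 2 <= ip x x * ip y y.
Proof.
move=> Hx Hy; apply: discriminant_le => [|t]; first exact: sip_ge0 sp _ Hy.
by rewrite -ip_quad//; apply: (sip_ge0 sp); apply: sipD => //; exact: sipZ.
Qed.

Lemma cauchy_schwarz x y : H x -> H y -> `|ip x y| <= nrm x * nrm y.
Proof.
move=> Hx Hy; rewrite -(@ler_pXn2r _ 2)// ?nnegrE ?mulr_ge0 ?nrm_ge0//.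
by rewrite exprMn !nrm_sqr// real_normK ?num_real// ip_sqr_le.
Qed.

Lemma nrmD_le x y : H x -> H y -> nrm (x + y) <= nrm x + nrm y.
Proof.
move=> Hx Hy; rewrite -(@ler_pXn2r _ 2)// ?nnegrE ?addr_ge0 ?nrm_ge0//.
have := cauchy_schwarz Hx Hy; have := ler_norm (ip x y).
have := @ip_quad 1 x y Hx Hy; rewrite scale1r nrm_sqr; last exact: sipD.
by rewrite sqrrD !nrm_sqr//; lra.
Qed.

Lemma nrmZ a x : H x -> nrm (a *: x) = `|a| * nrm x.
Proof.
move=> Hx; rewrite /ip_norm ipZl// ?ipZr//; last exact: sipZ.
by rewrite mulrA -expr2 sqrtrM ?sqr_ge0// sqrtr_sqr.
Qed.

Lemma nrmN x : H x -> nrm (- x) = nrm x.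
Proof. by move=> Hx; rewrite -scaleN1r nrmZ// normrN1 mul1r. Qed.

Lemma nrm_distC x y : H x -> H y -> nrm (x - y) = nrm (y - x).
Proof. by move=> Hx Hy; rewrite -[x - y]opprB nrmN//; exact: sipB. Qed.

Lemma nrm0 : nrm 0 = 0.
Proof. by rewrite /ip_norm ip0l ?sqrtr0//; exact: sip0 sp. Qed.

Lemma nrm0_ip x y : H x -> H y -> nrm x = 0 -> ip x y = 0.
Proof.
move=> Hx Hy x0; have := cauchy_schwarz Hx Hy.
by rewrite x0 mul0r normr_le0 => /eqP.
Qed.

Lemma ip_cvgP u x : ip_cvg ip u x <->
  forall e, 0 < e -> exists N, forall n, (N <= n)%N -> nrm (u n - x) < e.
Proof.
rewrite /ip_cvg cvg_seqP; split=> h e /h [N hN]; exists N => n /hN;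
  by rewrite subr0 ger0_norm ?nrm_ge0.
Qed.

Lemma ip_cvgl u x y : (forall n, H (u n)) -> H x -> H y -> ip_cvg ip u x ->
  ip (u n) y @[n --> \oo] --> ip x y.
Proof.
move=> Hu Hx Hy /ip_cvgP ux; apply/cvg_seqP => e e0.
have y1 : 0 < nrm y + 1 by have := nrm_ge0 y; lra.
have [N hN] := ux (e / (nrm y + 1)) (divr_gt0 e0 y1); exists N => n /hN.
rewrite -ipBl// ltr_pdivlMr// => h.
apply: (le_lt_trans (cauchy_schwarz (sipB (Hu n) Hx) Hy)).
by have := nrm_ge0 (u n - x); nra.
Qed.

Lemma ip_cvg_cauchy u x : (forall n, H (u n)) -> H x -> ip_cvg ip u x ->
  ip_cauchy ip u.
Proof.
move=> Hu Hx /ip_cvgP ux e e0.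
have s0 : 0 < Num.sqrt e / 2 by rewrite divr_gt0// sqrtr_gt0.
have [N hN] := ux _ s0; exists N => m n Nm Nn.
have := hN m Nm; have := hN n Nn => h1 h2.
have h : nrm (u m - u n) < Num.sqrt e.
  have -> : u m - u n = (u m - x) + (x - u n) by rewrite addrA subrK.
  apply: (le_lt_trans (nrmD_le _ _)); [exact: sipB|exact: sipB|].
  by rewrite (nrm_distC Hx (Hu n)); lra.
rewrite -nrm_sqr; last exact: sipB.
rewrite -[e]sqr_sqrtr ?ltW//.
by rewrite ltr_pXn2r// ?nnegrE ?nrm_ge0// sqrtr_ge0.
Qed.

Lemma ip_cauchyP u : (forall n, H (u n)) -> (ip_cauchy ip u <->
  forall e, 0 < e -> exists N, forall m n, (N <= m)%N -> (N <= n)%N ->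
    nrm (u m - u n) < e).
Proof.
move=> Hu; split=> h e e0.
  have [N hN] := h (e ^+ 2) (exprn_gt0 2 e0); exists N => m n Nm Nn.
  have := hN m n Nm Nn; rewrite -nrm_sqr; last exact: sipB.
  by rewrite ltr_pXn2r// nnegrE ?nrm_ge0// ltW.
have [|N hN] := h (Num.sqrt e); first by rewrite sqrtr_gt0.
exists N => m n Nm Nn; have := hN m n Nm Nn.
rewrite -nrm_sqr; last exact: sipB.
by rewrite -[e in _ -> _ < e]sqr_sqrtr ?ltW// ltr_pXn2r// ?nnegrE ?nrm_ge0 ?sqrtr_ge0.
Qed.

Lemma ip_cvg_lin a u v x y : (forall n, H (u n)) -> (forall n, H (v n)) ->
    H x -> H y -> ip_cvg ip u x -> ip_cvg ip v y ->
  ip_cvg ip (fun n => a *: u n + v n) (a *: x + y).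
Proof.
move=> Hu Hv Hx Hy /ip_cvgP ux /ip_cvgP vy; apply/ip_cvgP => e e0.
have a1 : 0 < `|a| + 1 by have := normr_ge0 a; lra.
have e2 : 0 < e / 2 by lra.
have [N hN] := ux _ (divr_gt0 e2 a1); have [N' hN'] := vy _ e2.
exists (maxn N N') => n; rewrite geq_max => /andP[/hN h1 /hN' h2].
have Hux := sipB (Hu n) Hx; have Hvy := sipB (Hv n) Hy.
rewrite opprD addrACA -scalerBr.
apply: le_lt_trans (nrmD_le (sipZ a Hux) Hvy) _; rewrite nrmZ//.
move: h1; rewrite ltr_pdivlMr// => h1.
by have := nrm_ge0 (u n - x); nra.
Qed.

Lemma ip_cauchy_lin a u v : (forall n, H (u n)) -> (forall n, H (v n)) ->
  ip_cauchy ip u -> ip_cauchy ip v -> ip_cauchy ip (fun n => a *: u n + v n).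
Proof.
move=> Hu Hv /(ip_cauchyP Hu) cu /(ip_cauchyP Hv) cv.
apply/ip_cauchyP => [n|e e0]; first exact: (sip_lin sp).
have a1 : 0 < `|a| + 1 by have := normr_ge0 a; lra.
have e2 : 0 < e / 2 by lra.
have [N hN] := cu _ (divr_gt0 e2 a1); have [N' hN'] := cv _ e2.
exists (maxn N N') => m n; rewrite !geq_max => /andP[m1 m2] /andP[n1 n2].
have := hN _ _ m1 n1; have := hN' _ _ m2 n2.
have Huu := sipB (Hu m) (Hu n); have Hvv := sipB (Hv m) (Hv n).
move=> h2; rewrite ltr_pdivlMr// => h1; rewrite opprD addrACA -scalerBr.
apply: le_lt_trans (nrmD_le (sipZ a Huu) Hvv) _; rewrite nrmZ//.
by have := nrm_ge0 (u m - u n); nra.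
Qed.

Lemma ip_cvg_cst x : H x -> ip_cvg ip (fun=> x) x.
Proof. by move=> Hx; rewrite /ip_cvg subrr nrm0; exact: cvg_cst. Qed.

Lemma ip_cauchy_cst x : H x -> ip_cauchy ip (fun=> x).
Proof.
by move=> Hx e e0; exists 0%N => m n _ _; rewrite subrr ip0l//; exact: sip0 sp.
Qed.

Lemma nrm_lip x y : H x -> H y -> `|nrm x - nrm y| <= nrm (x - y).
Proof.
move=> Hx Hy; have := nrmD_le (sipB Hx Hy) Hy; have := nrmD_le (sipB Hy Hx) Hx.
by rewrite !subrK (nrm_distC Hy Hx) ler_norml; lra.
Qed.

(** The norm is 1-Lipschitz, so the norms form a Cauchy sequence of reals. This applies to the form
    on smooth functions, before its closure is built. *)
Lemma ip_cauchy_norm u : (forall n, H (u n)) -> ip_cauchy ip u ->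
  exists r : R, nrm (u n) @[n --> \oo] --> r.
Proof.
move=> Hu /(ip_cauchyP Hu) cu; exists (limn (fun n => nrm (u n))).
suff : cvgn (fun n => nrm (u n)) by [].
apply/cauchy_cvgP/cauchy_ballP => e e0.
have [N hN] := cu _ e0.
exists ([set nrm (u n) | n in [set n | (N <= n)%N]],
        [set nrm (u n) | n in [set n | (N <= n)%N]]).
  by split; exists N => // n Nn; exists n.
move=> [_ _] /= [[m Nm <-] [n Nn <-]]; rewrite /ball/=.
exact: le_lt_trans (nrm_lip (Hu m) (Hu n)) (hN _ _ Nm Nn).
Qed.

Lemma ip_cauchy_bounded u : (forall n, H (u n)) -> ip_cauchy ip u ->
  exists N M, 0 < M /\ forall n, (N <= n)%N -> nrm (u n) < M.
Proof.
move=> Hu /(ip_cauchyP Hu)/(_ 1 ltr01)[N hN].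
exists N, (nrm (u N) + 1); split=> [|n Nn]; first by have := nrm_ge0 (u N); lra.
have := hN _ _ Nn (leqnn N); have := nrm_lip (Hu n) (Hu N).
by have := ler_norm (nrm (u n) - nrm (u N)); lra.
Qed.

(** Polarisation, in the shape [a *: x + y] of [approx_lin], so that limits of norms yield limits of
    the form. *)
Lemma ip_polar x y : H x -> H y ->
  ip x y = (nrm (1 *: x + y) ^+ 2 - nrm ((-1) *: x + y) ^+ 2) / 4.
Proof.
move=> Hx Hy; rewrite !nrm_sqr; [|exact: (sip_lin sp)..].
by rewrite ![_ *: x + y]addrC !ip_quad// (sipC sp Hy Hx); field.
Qed.

(* Parallelogram law and minimisation of [ip h h - 2 F h]. *)
Lemma riesz_closure (L : set V) (F : V -> R) (C : R) : L `<=` H ->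
    (forall a x y, L x -> L y -> L (a *: x + y)) -> L 0 ->
    (forall a x y, L x -> L y -> F (a *: x + y) = a * F x + F y) ->
    (forall x, L x -> `|F x| <= C * nrm x) -> ip_complete H ip ->
  exists u p, [/\ forall n, L (u n), H p, ip_cvg ip u p &
    forall h, L h -> ip p h = F h].
Proof.
move=> LH Llin L0 Flin Fbd Hc.
pose J h := ip h h - 2 * F h.
have J_ge h : L h -> - C ^+ 2 <= J h.
  move=> Lh; rewrite /J -nrm_sqr; last exact: LH.
  have := Fbd h Lh; have := ler_norm (F h).
  by have := sqr_ge0 (nrm h - C); rewrite sqrrB; lra.
pose E := [set J h | h in L].
have E_inf : has_inf E.
  by split; [exists (J 0); exists 0|exists (- C ^+ 2) => _ [h Lh <-]; exact: J_ge].
have inf_le h : L h -> inf E <= J h.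
  by move=> Lh; apply: ge_inf; [exact: E_inf.2|exists h].
have /choice[u hu] : forall n : nat, exists h, L h /\ J h < inf E + n.+1%:R^-1.
  move=> n; have [|_ [h Lh <-] hJ] := @inf_adherent _ E (n.+1%:R^-1) _ E_inf.
    by rewrite invr_gt0.
  by exists h.
have Lu n : L (u n) by case: (hu n).
have Hu n : H (u n) by exact: LH.
(* [u n] minimises [J] up to 1/(n+1), so moving along h cannot lower [J] by more; the discriminant
   then gives an approximate Euler-Lagrange equation. *)
have var n t h : L h ->
    0 <= n.+1%:R^-1 + 2 * t * (ip (u n) h - F h) + t ^+ 2 * ip h h.
  move=> Lh; have Lth : L (t *: h + u n) by exact: Llin.
  have := inf_le _ Lth; have [_] := hu n.
  rewrite /J Flin// [t *: h + u n]addrC ip_quad//; last exact: LH.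
  by move: (n.+1%:R^-1) => r; lra.
have near_F n h : L h -> (ip (u n) h - F h) ^+ 2 <= n.+1%:R^-1 * ip h h.
  by move=> Lh; apply: discriminant_le => [|t];
    [apply: (sip_ge0 sp); exact: LH|exact: var].
have u_cauchy : ip_cauchy ip u.
  move=> e e0.
  have e4 : 0 < e / 4 by lra.
  have [N hN] := invn_lt e4; exists N => m n Nm Nn.
  (* At the midpoint, J (u m) + J (u n) - 2 J (mid) is half the squared distance of [u m] and [u n],
     whence the two bounds [e / 4]. The trailing 0 matches [Llin]. *)
  have Lmid : L (2^-1 *: u m + (2^-1 *: u n + 0)).
    by apply: (Llin) => //; exact: Llin.
  have := inf_le _ Lmid; have [_] := hu m; have [_] := hu n.
  rewrite /J !Flin//; last exact: Llin.
  have -> : F 0 = 0.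
    have := Flin 1 0 0 L0 L0; rewrite scale1r addr0 mul1r.
    by move: (F 0) => r; lra.
  rewrite !addr0 -scalerDr ipZl ?ipZr//; try exact: sipD; last first.
    by apply: sipZ; exact: sipD.
  have := @ip_quad 1 _ _ (Hu m) (Hu n); rewrite scale1r => ->.
  have := @ip_quad (-1) _ _ (Hu m) (Hu n); rewrite scaleN1r => ->.
  have := hN m Nm; have := hN n Nn.
  by move: (m.+1%:R^-1) (n.+1%:R^-1) => r1 r2; lra.
have [p Hp up] := Hc u Hu u_cauchy.
exists u, p; split => // h Lh.
have Hh := LH _ Lh.
apply: (seq_lim_unique (ip_cvgl Hu Hp Hh up)).
apply/cvg_seqP => e e0.
have q1 : 0 < ip h h + 1 by have := sip_ge0 sp Hh; lra.
have [N hN] := invn_lt (divr_gt0 (exprn_gt0 2 e0) q1); exists N => n Nn.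
rewrite -(@ltr_pXn2r _ 2)// ?nnegrE ?normr_ge0 ?ltW//.
rewrite real_normK ?num_real//; apply: le_lt_trans (near_F n h Lh) _.
have := hN n Nn.
rewrite ltr_pdivlMr//; apply: le_lt_trans.
by rewrite ler_pM2l ?invr_gt0//; lra.
Qed.

(** Closedness of [L] puts the limit into [L]. The version with a sequence in [L] serves the range
    of S, which need not be closed. *)
Lemma riesz_closed (L : set V) (F : V -> R) (C : R) : L `<=` H ->
    (forall a x y, L x -> L y -> L (a *: x + y)) -> L 0 ->
    (forall u p, (forall n, L (u n)) -> H p -> ip_cvg ip u p -> L p) ->
    (forall a x y, L x -> L y -> F (a *: x + y) = a * F x + F y) ->
    (forall x, L x -> `|F x| <= C * nrm x) -> ip_complete H ip ->
  exists2 p, L p & forall h, L h -> ip p h = F h.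
Proof.
move=> LH Llin L0 Lcl Flin Fbd Hc.
have [u [p [Lu Hp up pF]]] := riesz_closure LH Llin L0 Flin Fbd Hc.
by exists p => //; exact: Lcl up.
Qed.

End SemiInner.

(** * Skew perturbations of the identity *)

Section SkewPerturbation.
Context {R : realType} {V : lmodType R} {H : set V} {ip : V -> V -> R}.
Hypothesis sp : semi_inner H ip.
Hypothesis Hc : ip_complete H ip.
Variables (beta : V -> V -> R) (C : R).
Hypothesis betaL : forall a x y z, H x -> H y -> H z ->
  beta (a *: x + y) z = a * beta x z + beta y z.
Hypothesis beta_skew : forall x y, H x -> H y -> beta x y = - beta y x.
Hypothesis beta_bounded : forall x y, H x -> H y ->
  `|beta x y| <= C * ip_norm ip x * ip_norm ip y.
Local Notation nrm := (ip_norm ip).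

(** The weak form of (1 - c S) x = f. Stating it through [beta] spares choosing a map S, which [ip]
    determines only up to null vectors. *)
Definition skew_solution (c : R) (f x : V) : Prop :=
  H x /\ forall h, H h -> ip x h - c * beta x h = ip f h.

Definition skew_kernel : set V :=
  [set x | H x /\ forall h, H h -> beta x h = 0].

Lemma betaR a x y z : H x -> H y -> H z ->
  beta z (a *: x + y) = a * beta z x + beta z y.
Proof.
move=> Hx Hy Hz; rewrite beta_skew//; last exact: (sip_lin sp).
by rewrite betaL// (beta_skew Hx Hz) (beta_skew Hy Hz); ring.
Qed.

Lemma beta0l x : H x -> beta 0 x = 0.
Proof.
move=> Hx; have H0 := sip0 sp; have := betaL 1 H0 H0 Hx.
by rewrite scale1r addr0; lra.
Qed.

Lemma beta_diag x : H x -> beta x x = 0.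
Proof. by move=> Hx; have := beta_skew Hx Hx; lra. Qed.

(** Testing with x itself kills the skew term for every c; the bounds uniform in c come from
    here. *)
Lemma skew_solution_sqr c f x : skew_solution c f x -> ip x x = ip f x.
Proof. by case=> Hx /(_ x Hx) <-; rewrite beta_diag// mulr0 subr0. Qed.

Lemma skew_solution_le c f x : H f -> skew_solution c f x -> nrm x <= nrm f.
Proof.
move=> Hf sx; have [Hx _] := sx.
have := cauchy_schwarz sp Hf Hx; rewrite -(skew_solution_sqr sx).
rewrite ger0_norm ?(sip_ge0 sp)// -(nrm_sqr sp Hx).
have [->|x0] := eqVneq (nrm x) 0; first by rewrite nrm_ge0.
by rewrite expr2 ler_pM2r// lt_neqAle eq_sym x0 nrm_ge0.
Qed.

Lemma skew_solution_lin c a f g x y : H f -> H g ->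
  skew_solution c f x -> skew_solution c g y ->
  skew_solution c (a *: f + g) (a *: x + y).
Proof.
move=> Hf Hg [Hx sx] [Hy sy]; split; first exact: (sip_lin sp).
by move=> h Hh; rewrite !(sipL sp)// betaL// -sx// -sy//; ring.
Qed.

Lemma riesz (F : V -> R) (D : R) :
    (forall a x y, H x -> H y -> F (a *: x + y) = a * F x + F y) ->
    (forall x, H x -> `|F x| <= D * nrm x) ->
  exists2 p, H p & forall h, H h -> ip p h = F h.
Proof.
move=> Flin Fbd; apply: (riesz_closed sp _ _ _ _ Flin Fbd Hc) => //.
- exact: sip_lin sp.
- exact: sip0 sp.
Qed.

(** The vector s is S x. Since [beta] is skew, it also writes [beta _ x] as [- ip _ s], which gives
    continuity of [beta] in its first argument. *)
Lemma skew_adjoint_repr x : H x ->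
  exists2 s, H s & forall h, H h -> ip s h = beta x h.
Proof.
move=> Hx; apply: (@riesz _ (C * nrm x)) => [a y z Hy Hz|y Hy].
  exact: betaR.
exact: beta_bounded.
Qed.

(* The range of [1 - c S], with [S] the skew operator representing [beta], is
   closed since [1 - c S] does not decrease norms, and dense since
   [ip z ((1 - c S) z) = ip z z]. *)
Lemma skew_solvable c f : H f -> exists x, skew_solution c f x.
Proof.
move=> Hf; pose L := [set y | H y /\ exists x, skew_solution c y x].
have [|||||p [Hp [x sx]] pf] := @riesz_closed _ _ H ip sp L (ip f) (nrm f)
  (fun x Lx => Lx.1) _ _ _ _ _ Hc.
- move=> a y z [Hy [x sx]] [Hz [x' sx']]; split; first exact: (sip_lin sp).
  by exists (a *: x + x'); exact: skew_solution_lin.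
- split; first exact: (sip0 sp).
  exists 0; split=> [|h Hh]; first exact: (sip0 sp).
  by rewrite (ip0l sp)// beta0l// mulr0 subr0.
- move=> u p Lu Hp up; split=> //.
  have Hu n : H (u n) by case: (Lu n).
  have /choice[x sx] : forall n, exists x, skew_solution c (u n) x.
    by move=> n; case: (Lu n).
  have Hx n : H (x n) by case: (sx n).
  (* Differences of solutions solve the equation for the differences of the data, so the contraction
     bound transfers the Cauchy property. *)
  have x_cauchy : ip_cauchy ip x.
    apply/(ip_cauchyP sp) => // e e0.
    have /(ip_cauchyP sp Hu)/(_ e e0)[N hN] := ip_cvg_cauchy sp Hu Hp up.
    exists N => m n Nm Nn; apply: le_lt_trans (hN m n Nm Nn).
    apply: (@skew_solution_le c); first exact: (sipB sp).
    rewrite [u m - _]addrC [x m - _]addrC -[- u n]scaleN1r -[- x n]scaleN1r.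
    exact: skew_solution_lin.
  have [y Hy xy] := Hc Hx x_cauchy; exists y; split => // h Hh.
  apply: (@seq_lim_unique _ (fun n => ip (u n) h)); last exact: (ip_cvgl sp).
  rewrite (_ : (fun n => ip (u n) h) = (fun n => ip (x n) h - c * beta (x n) h)); last first.
    by apply/funext => n; rewrite (sx n).2.
  apply: cvgB; first exact: (ip_cvgl sp).
  apply: cvgM; first exact: cvg_cst.
  have [s Hs hs] := skew_adjoint_repr Hh.
  rewrite (_ : (fun n => beta (x n) h) = (fun n => - ip (x n) s)); last first.
    by apply/funext => n; rewrite (sipC sp)// hs// -beta_skew.
  rewrite (beta_skew Hy Hh) -hs// (sipC sp Hs Hy).
  by apply: cvgN; exact: (ip_cvgl sp).
- by move=> a y z [Hy _] [Hz _]; rewrite (ipDr sp) ?(ipZr sp)//; exact: (sipZ sp).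
- by move=> y [Hy _]; exact: (cauchy_schwarz sp Hf Hy).
(* p represents f on the range [L]. As y = (1 - c S) (f - p) lies in [L], it is orthogonal to f - p,
   while skewness gives <y, f - p> = |f - p|^2. So f - p is null, and the solution for p is one for
   f. *)
exists x; split; first by case: sx.
have Hz : H (f - p) by exact: (sipB sp).
have [s Hs hs] := skew_adjoint_repr Hz.
have Hy : H (f - p - c *: s) by apply: (sipB sp) => //; exact: (sipZ sp).
have Ly : L (f - p - c *: s).
  split=> //; exists (f - p); split => // h Hh.
  by rewrite [RHS](ipBl sp) ?(ipZl sp c Hs Hh) ?hs//; exact: (sipZ sp).
have := pf _ Ly; rewrite (sipC sp Hp Hy) (sipC sp Hf Hy) => py.
have z0 : nrm (f - p) = 0.
  rewrite /ip_norm; have -> : ip (f - p) (f - p) = 0; last by rewrite sqrtr0.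
  have : ip (f - p - c *: s) (f - p) = 0 by rewrite (ipBr sp)// py subrr.
  rewrite (ipBl sp)//; last exact: (sipZ sp).
  by rewrite (ipZl sp)// hs// beta_diag// mulr0 subr0.
move=> h Hh; rewrite sx.2//; apply/eqP; rewrite eq_sym -subr_eq0 -(ipBl sp)//.
by apply/eqP; exact: (nrm0_ip sp).
Qed.

(** The kernel is closed because each [beta _ h] is continuous, so representing [ip f] on it yields
    the projection. *)
Lemma skew_kernel_proj f : H f ->
  exists2 p, skew_kernel p & forall h, skew_kernel h -> ip (f - p) h = 0.
Proof.
move=> Hf; have [|||||p Kp pf] := @riesz_closed _ _ H ip sp skew_kernel (ip f)
  (nrm f) (fun x Kx => Kx.1) _ _ _ _ _ Hc.
- move=> a x y [Hx x0] [Hy y0]; split; first exact: (sip_lin sp).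
  by move=> h Hh; rewrite betaL// x0// y0// mulr0 addr0.
- by split=> [|h Hh]; [exact: (sip0 sp)|rewrite beta0l].
- move=> u p Ku Hp up; split=> // h Hh.
  have [s Hs hs] := skew_adjoint_repr Hh.
  rewrite (beta_skew Hp Hh) -hs// (sipC sp Hs Hp).
  have Hu n : H (u n) by case: (Ku n).
  rewrite (@seq_lim_unique _ _ (ip p s) 0 (ip_cvgl sp Hu Hp Hs up)) ?oppr0//.
  rewrite (_ : (fun n => ip (u n) s) = cst 0); first exact: cvg_cst.
  by apply/funext => n; rewrite (sipC sp)// hs// beta_skew// (Ku n).2// oppr0.
- by move=> a y z [Hy _] [Hz _]; rewrite (ipDr sp) ?(ipZr sp)//; exact: (sipZ sp).
- by move=> y [Hy _]; exact: (cauchy_schwarz sp Hf Hy).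
exists p => // h Kh; rewrite (ipBl sp)//; [|exact: Kp.1|exact: Kh.1].
by rewrite pf// subrr.
Qed.

Definition skew_range : set V :=
  [set s | H s /\ exists2 w, H w & forall h, H h -> ip s h = beta w h].

(** Let p be the projection of q on the closure of the range. Then q - p is orthogonal to every S h,
    hence in the kernel by skewness, hence orthogonal to q; it is also orthogonal to p, a limit of
    elements of the range. So q - p is null, and elements of the range close to p are close to q. *)
Lemma skew_range_dense q e : H q -> 0 < e ->
    (forall h, skew_kernel h -> ip q h = 0) ->
  exists2 s, skew_range s & nrm (q - s) < e.
Proof.
move=> Hq e0 qK.
have [||||u [p [Lu Hp up pq]]] := @riesz_closure _ _ H ip sp skew_range (ip q)
  (nrm q) (fun x Lx => Lx.1) _ _ _ _ Hc.
- move=> a x y [Hx [w Hw xw]] [Hy [w' Hw' yw]]; split; first exact: (sip_lin sp).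
  exists (a *: w + w') => [|h Hh]; first exact: (sip_lin sp).
  by rewrite (sipL sp)// betaL// xw// yw.
- split; first exact: (sip0 sp).
  exists 0 => [|h Hh]; first exact: (sip0 sp).
  by rewrite (ip0l sp)// beta0l.
- by move=> a y z [Hy _] [Hz _]; rewrite (ipDr sp) ?(ipZr sp)//; exact: (sipZ sp).
- by move=> y [Hy _]; exact: (cauchy_schwarz sp Hq Hy).
have Hu n : H (u n) by case: (Lu n).
have Hz : H (q - p) by exact: (sipB sp).
have z_perp s : skew_range s -> ip (q - p) s = 0.
  by move=> Ls; rewrite (ipBl sp)//; [rewrite pq// subrr|exact: Ls.1].
have zK : skew_kernel (q - p).
  split=> // h Hh; have [s Hs hs] := skew_adjoint_repr Hh.
  rewrite (beta_skew Hz Hh) -hs// (sipC sp Hs Hz) z_perp ?oppr0//.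
  by split=> //; exists h.
have pz : ip p (q - p) = 0.
  apply: (seq_lim_unique (ip_cvgl sp Hu Hp Hz up)).
  rewrite (_ : (fun n => ip (u n) (q - p)) = cst 0); first exact: cvg_cst.
  by apply/funext => n; rewrite (sipC sp)// z_perp.
have z0 : nrm (q - p) = 0.
  by rewrite /ip_norm (ipBl sp)// pz (qK _ zK) subrr sqrtr0.
have /(ip_cvgP)/(_ e e0)[N hN] := up.
exists (u N) => //; rewrite -[q](subrK p) -addrA.
apply: le_lt_trans (hN N (leqnn N)).
apply: le_trans (nrmD_le sp _ _) _ => //; first exact: (sipB sp).
by rewrite z0 add0r (nrm_distC sp).
Qed.

(* With [q = f - p] and [s = S w] close to [q], the element
   [x_c - p + w / c] solves the equation with right-hand side
   [q - s + w / c]. *)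
Lemma skew_solution_cvg f p (x : R -> V) : H f -> skew_kernel p ->
    (forall h, skew_kernel h -> ip (f - p) h = 0) ->
    (forall c, skew_solution c f (x c)) ->
  forall e, 0 < e -> exists D, forall c, D < `|c| -> nrm (x c - p) < e.
Proof.
move=> Hf [Hp p0] pK sx e e0.
have Hq : H (f - p) by exact: (sipB sp).
have e2 : 0 < e / 2 by lra.
have [s [Hs [w Hw sw]] qs] := skew_range_dense Hq e2 pK.
have Hr : H (f - p - s) by exact: (sipB sp).
(* The factor 2 arises because w / c is paid twice, in the right-hand side and when it is removed
   from the solution; q - s takes the other e / 2. *)
pose D := 2 * nrm w / (e / 2).
have D0 : 0 <= D by rewrite divr_ge0 ?mulr_ge0 ?nrm_ge0// ltW.
exists D => c Dc.
have c0 : 0 < `|c| by exact: le_lt_trans Dc.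
have c_neq0 : c != 0 by rewrite -normr_gt0.
have Hx : H (x c) by case: (sx c).
have Hy : H (x c - p) by exact: (sipB sp).
have Hcw : H (c^-1 *: w) by exact: (sipZ sp).
have sol : skew_solution c (f - p - s + c^-1 *: w) (x c - p + c^-1 *: w).
  split=> [|h Hh]; first exact: (sipD sp).
  rewrite [x c - p + _]addrC betaL//.
  rewrite [x c - p]addrC -scaleN1r betaL// p0// scaleN1r.
  rewrite addrC [in ip (- p + _ + _)]addrC.
  have Hmp := sipN sp Hp; have Hpx := sipD sp Hmp Hx.
  rewrite !(ipDl sp)//; try exact: (sipN sp); try exact: (sipD sp).
  rewrite !(ipNl sp)// !(ipZl sp)// sw// -(sx c).2//.
  by field.
have sol_le := skew_solution_le (sipD sp Hr Hcw) sol.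
have w_small : 2 * (`|c|^-1 * nrm w) < e / 2.
  by rewrite mulrC -mulrA ltr_pdivrMl// mulrC -ltr_pdivrMr// mulrC.
have -> : x c - p = (x c - p + c^-1 *: w) - c^-1 *: w by rewrite addrK.
apply: le_lt_trans (nrmD_le sp (sipD sp Hy Hcw) (sipN sp Hcw)) _.
have := nrmD_le sp Hr Hcw; rewrite (nrmN sp)// (nrmZ sp)// normfV; lra.
Qed.

End SkewPerturbation.

(** * Closure of a quadratic form *)

Section FormClosure.
Context {R : realType} {V : lmodType R} {L2 : set V} {inner : V -> V -> R}.
Context {Sm : set V} {D0 : V -> V -> R}.
Hypothesis sp2 : semi_inner L2 inner.
Hypothesis L2_complete : ip_complete L2 inner.
Hypothesis spS : semi_inner Sm D0.
Hypothesis Sm_L2 : Sm `<=` L2.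
Hypothesis D0_op : forall h, Sm h -> exists2 k, L2 k &
  forall s, Sm s -> D0 s h = - inner s k.

(* [approx], [cdom], [cform] and [cval] are the abstract versions of
   [form_approx], [form_domain], [closed_form] and [dirichlet]. *)
Definition approx (f : V) (s : nat -> V) : Prop :=
  [/\ forall n, Sm (s n), ip_cvg inner s f & ip_cauchy D0 s].

Definition cdom (f : V) : Prop := L2 f /\ exists s, approx f s.

Definition cform (f h : V) (r : R) : Prop :=
  forall s t, approx f s -> approx h t -> D0 (s n) (t n) @[n --> \oo] --> r.

Definition cval (f h : V) : R := get [set r | cform f h r].

Let SmL (s : nat -> V) (Hs : forall n, Sm (s n)) n : L2 (s n) := Sm_L2 (Hs n).

Lemma approx_lin a f h s t : L2 f -> L2 h -> approx f s -> approx h t ->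
  approx (a *: f + h) (fun n => a *: s n + t n).
Proof.
move=> Lf Lh [Ss sf cs] [St th ct]; split.
- by move=> n; exact: (sip_lin spS).
- by apply: (ip_cvg_lin sp2) => //; exact: SmL.
- exact: (ip_cauchy_lin spS).
Qed.

Lemma approx_cst f : Sm f -> approx f (fun=> f).
Proof.
move=> Sf; split=> //; first exact: (ip_cvg_cst sp2 (Sm_L2 Sf)).
exact: (ip_cauchy_cst spS).
Qed.

Lemma cdom_smooth f : Sm f -> cdom f.
Proof.
move=> Sf; split; first exact: Sm_L2.
by exists (fun=> f); exact: approx_cst.
Qed.

(* Closability: [D0 (z n) (z n)] is split as
   [D0 (z n) (z n - z N) + D0 (z n) (z N)], and the last term tends to 0 since
   [D0 _ (z N)] is L^2-continuous. *)
Lemma approx_null z : approx 0 z -> ip_norm D0 (z n) @[n --> \oo] --> (0 : R).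
Proof.
move=> [Sz z0 cz]; apply/cvg_seqP => e e0.
have [N1 [M [M0 hM]]] := ip_cauchy_bounded spS Sz cz.
have ee : 0 < e ^+ 2 / 2 by rewrite divr_gt0// exprn_gt0.
have [N2 hN2] := (ip_cauchyP spS Sz).1 cz _ (divr_gt0 ee M0).
(* N is frozen before n grows: the vector [k] representing [D0 _ (z N)] depends on it. *)
pose N := maxn N1 N2.
have [k Lk hk] := D0_op (Sz N).
have := ip_cvgl sp2 (SmL Sz) (sip0 sp2) Lk z0.
rewrite (ip0l sp2)// => /cvg_seqP/(_ _ ee)[N3 hN3].
exists (maxn N N3) => n; rewrite geq_max => /andP[Nn /hN3].
have [n1 n2] : (N1 <= n)%N /\ (N2 <= n)%N by apply/andP; rewrite -geq_max.
rewrite !subr0 (ger0_norm (nrm_ge0 _)) => small.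
rewrite -(@ltr_pXn2r _ 2)// ?nnegrE ?nrm_ge0 ?ltW// (nrm_sqr spS)//.
rewrite -[X in D0 _ X](subrK (z N)) (ipDr spS)//; last exact: (sipB spS).
rewrite hk//; have := cauchy_schwarz spS (Sz n) (sipB spS (Sz n) (Sz N)).
have := hN2 n N n2 (leq_maxr _ _); rewrite ltr_pdivlMr// => h2.
have := hM n n1; have := nrm_ge0 (ip := D0) (z n - z N) => p0 hn.
have := nrm_ge0 (ip := D0) (z n) => q0.
have := ler_norm (D0 (z n) (z n - z N)); have := ler_norm (- inner (z n) k).
by rewrite normrN; move: small; move: (ip_norm D0 (z n - z N)) (ip_norm D0 (z n))
  p0 q0 h2 hn => p q p0 q0 h2 hn; nra.
Qed.

(** The difference of two approximating sequences approximates 0, so closability makes the limit of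
    norms independent of the sequence. *)
Lemma approx_norm f s t (r : R) : L2 f -> approx f s -> approx f t ->
  ip_norm D0 (s n) @[n --> \oo] --> r -> ip_norm D0 (t n) @[n --> \oo] --> r.
Proof.
move=> Lf hs ht /cvg_seqP sr.
have := approx_lin (-1) Lf Lf ht hs; rewrite scaleN1r addNr.
move=> /approx_null/cvg_seqP st; apply/cvg_seqP => e e0.
have e2 : 0 < e / 2 by lra.
have [N hN] := sr _ e2; have [N' hN'] := st _ e2.
have [Ss _ _] := hs; have [St _ _] := ht.
exists (maxn N N') => n; rewrite geq_max => /andP[/hN + /hN'].
rewrite subr0 (ger0_norm (nrm_ge0 _)) scaleN1r [- t n + _]addrC.
have := nrm_lip spS (Ss n) (St n); rewrite ler_norml !ltr_norml.
by lra.
Qed.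

(** [cform] asks for one limit along all approximating sequences. Polarisation reduces it to norms,
    which converge along one sequence and hence along every other. *)
Lemma cform_ex f h : cdom f -> cdom h -> exists r, cform f h r.
Proof.
move=> [Lf [s hs]] [Lh [t ht]].
have pl := approx_lin 1 Lf Lh hs ht; have mi := approx_lin (-1) Lf Lh hs ht.
have [Spl _ cpl] := pl; have [Smi _ cmi] := mi.
have [r1 hr1] := ip_cauchy_norm spS Spl cpl.
have [r2 hr2] := ip_cauchy_norm spS Smi cmi.
exists ((r1 ^+ 2 - r2 ^+ 2) / 4) => s' t' hs' ht'.
have [Ss' _ _] := hs'; have [St' _ _] := ht'.
under eq_fun do rewrite (ip_polar spS)//.
have L1 a : L2 (a *: f + h) by exact: (sip_lin sp2).
have hr1' := approx_norm (L1 _) pl (approx_lin 1 Lf Lh hs' ht') hr1.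
have hr2' := approx_norm (L1 _) mi (approx_lin (-1) Lf Lh hs' ht') hr2.
apply: cvgM; last exact: cvg_cst.
by apply: cvgB; rewrite expr2; under eq_fun do rewrite expr2; exact: cvgM.
Qed.

Lemma cvalP f h : cdom f -> cdom h -> cform f h (cval f h).
Proof.
move=> df dh; apply: (@getPex _ [set r | cform f h r]); exact: cform_ex.
Qed.

Lemma cval_eq f h r : cdom f -> cdom h -> cform f h r -> cval f h = r.
Proof.
move=> df dh fh; have [_ [s hs]] := df; have [_ [t ht]] := dh.
exact: seq_lim_unique (cvalP df dh hs ht) (fh _ _ hs ht).
Qed.

Lemma cdom_lin a f h : cdom f -> cdom h -> cdom (a *: f + h).
Proof.
move=> [Lf [s hs]] [Lh [t ht]]; split; first exact: (sip_lin sp2).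
by exists (fun n => a *: s n + t n); exact: approx_lin.
Qed.

Lemma cval_semi_inner : semi_inner cdom cval.
Proof.
split.
- by apply: cdom_smooth; exact: (sip0 spS).
- exact: cdom_lin.
- move=> f h df dh; apply: cval_eq => // s t hs ht.
  have [Ss _ _] := hs; have [St _ _] := ht.
  under eq_fun do rewrite (sipC spS)//.
  exact: cvalP.
- move=> a f h k df dh dk; apply: cval_eq => //; first exact: cdom_lin.
  have [_ [s hs]] := df; have [_ [t ht]] := dh.
  have [Ss _ _] := hs; have [St _ _] := ht.
  have ht' := approx_lin a df.1 dh.1 hs ht.
  have [r hr] := cform_ex (cdom_lin a df dh) dk.
  have [_ [u hu]] := dk; have [Su _ _] := hu.
  suff -> : a * cval f k + cval h k = r by [].
  have := hr _ _ ht' hu; under eq_fun do rewrite (sipL spS)//.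
  apply: seq_lim_unique; apply: cvgD; last exact: cvalP.
  by apply: cvgM; [exact: cvg_cst|exact: cvalP].
- move=> f df; have [_ [s hs]] := df; have [Ss _ _] := hs.
  rewrite -oppr_le0; have := cvalP df df hs hs => /cvgN fs.
  apply: (seq_lim_le (N := 0) fs) => n _.
  by rewrite oppr_le0; exact: (sip_ge0 spS).
Qed.

Lemma cval_smooth f h : Sm f -> Sm h -> cval f h = D0 f h.
Proof.
move=> Sf Sh.
have := cvalP (cdom_smooth Sf) (cdom_smooth Sh) (approx_cst Sf) (approx_cst Sh).
by move/seq_lim_unique; apply; exact: cvg_cst.
Qed.

(** For fixed n, the sequence s n - s m in m approximates s n - f, so the form at s n - f is a limit
    of values controlled by the Cauchy property. *)
Lemma approx_cvg f s : L2 f -> approx f s -> ip_cvg cval s f.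
Proof.
move=> Lf hs; have [Ss sf cs] := hs.
have df : cdom f by split=> //; exists s.
have ds n : cdom (s n) by exact: cdom_smooth.
apply/ip_cvgP => e e0.
have e2 : 0 < (e / 2) ^+ 2 by rewrite exprn_gt0//; lra.
have [N hN] := cs _ e2; exists N => n Nn.
have dsf : cdom (s n - f) by exact: (sipB cval_semi_inner).
apply: (@le_lt_trans _ _ (e / 2)); last by lra.
rewrite -(@ler_pXn2r _ 2)// ?nnegrE ?nrm_ge0 ?divr_ge0// ?(ltW e0)//.
rewrite (nrm_sqr cval_semi_inner)//.
have ap : approx (s n - f) (fun m => s n - s m).
  have := approx_lin (-1) Lf (Sm_L2 (Ss n)) hs (approx_cst (Ss n)).
  by rewrite scaleN1r addrC; under eq_fun do rewrite scaleN1r addrC.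
apply: (seq_lim_le (N := N) (cvalP dsf dsf ap ap)) => m Nm.
by apply: ltW; exact: hN.
Qed.

(** An approximating sequence of f also approximates h. Thus the form domain consists of whole
    classes of functions. *)
Lemma cdom_eq f h : cdom f -> L2 h -> ip_norm inner (f - h) = 0 -> cdom h.
Proof.
move=> [Lf [s [Ss sf cs]]] Lh fh; split=> //; exists s; split=> //.
apply/ip_cvgP => e e0; have [N hN] := (ip_cvgP _ _).1 sf e e0.
exists N => n /hN; apply: le_lt_trans.
have -> : s n - h = (s n - f) + (f - h) by rewrite addrA subrK.
have Ls := Sm_L2 (Ss n).
apply: le_trans (nrmD_le sp2 (sipB sp2 Ls Lf) (sipB sp2 Lf Lh)) _.
by rewrite fh addr0.
Qed.

(** Smooth functions are dense in the form domain, simultaneously for the form and for L^2, so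
    smooth tests suffice. *)
Lemma weak_cval f u : cdom f -> L2 u ->
  (forall h, Sm h -> cval f h = - inner u h) ->
  forall h, cdom h -> cval f h = - inner u h.
Proof.
move=> df Lu fu h dh; have [Lh [t ht]] := dh; have [St th _] := ht.
have dt n : cdom (t n) by exact: cdom_smooth.
rewrite (sipC cval_semi_inner)// (sipC sp2)//.
have := ip_cvgl cval_semi_inner dt dh df (approx_cvg Lh ht).
move/seq_lim_unique; apply.
rewrite (_ : (fun n => _) = (fun n => - inner (t n) u)); last first.
  apply/funext => n; rewrite (sipC cval_semi_inner)// fu//.
  by rewrite (sipC sp2)//; exact: Sm_L2.
by apply: cvgN; apply: (ip_cvgl sp2) => // n; exact: Sm_L2.
Qed.

(** The abstract version of [inner1]. *)
Definition graph_ip (l : R) (f h : V) : R := cval f h + l * inner f h.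

Section GraphNorm.
Variables (l : R) (l_gt0 : 0 < l).

Lemma graph_semi_inner : semi_inner cdom (graph_ip l).
Proof.
have spc := cval_semi_inner; split.
- exact: (sip0 spc).
- exact: (sip_lin spc).
- move=> x y dx dy; rewrite /graph_ip (sipC spc)// (sipC sp2)//.
    by case: dx.
  by case: dy.
- move=> a x y z dx dy dz; rewrite /graph_ip (sipL spc)// (sipL sp2)//.
  + by ring.
  + by case: dx.
  + by case: dy.
  + by case: dz.
- move=> x dx; rewrite addr_ge0 ?mulr_ge0 ?(ltW l_gt0) ?(sip_ge0 spc)//.
  by apply: (sip_ge0 sp2); case: dx.
Qed.

Lemma cval_norm_le f : cdom f -> ip_norm cval f <= ip_norm (graph_ip l) f.
Proof.
move=> df; rewrite /ip_norm ler_sqrt.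
  by rewrite /graph_ip lerDl mulr_ge0 ?(ltW l_gt0)// (sip_ge0 sp2)//; case: df.
exact: (sip_ge0 graph_semi_inner).
Qed.

Lemma inner_norm_le f : cdom f ->
  Num.sqrt l * ip_norm inner f <= ip_norm (graph_ip l) f.
Proof.
move=> df; rewrite /ip_norm -sqrtrM ?(ltW l_gt0)// ler_sqrt.
  by rewrite /graph_ip lerDr (sip_ge0 cval_semi_inner).
exact: (sip_ge0 graph_semi_inner).
Qed.

Lemma graph_cvg u f : (forall n, cdom (u n)) -> cdom f ->
  ip_cvg cval u f -> ip_cvg inner u f -> ip_cvg (graph_ip l) u f.
Proof.
move=> du df /ip_cvgP u1 /ip_cvgP u2; apply/ip_cvgP => e e0.
have ee : 0 < e ^+ 2 / 2 by rewrite divr_gt0// exprn_gt0.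
have [|N1 hN1] := u1 (Num.sqrt (e ^+ 2 / 2)); first by rewrite sqrtr_gt0.
have [|N2 hN2] := u2 (Num.sqrt (e ^+ 2 / 2 / l)).
  by rewrite sqrtr_gt0 divr_gt0.
have eel : 0 < e ^+ 2 / 2 / l by rewrite divr_gt0.
exists (maxn N1 N2) => n; rewrite geq_max => /andP[/hN1 + /hN2].
rewrite /ip_norm (ltr_sqrt _ ee) (ltr_sqrt _ eel) => h1.
rewrite ltr_pdivlMr// => h2.
rewrite -[e]ger0_norm ?(ltW e0)// -sqrtr_sqr ltr_sqrt ?exprn_gt0//.
by rewrite /graph_ip; lra.
Qed.

(** A diagonal argument: each [u n] is replaced by a smooth [s n] within 1/(n+1) in both norms. The
    sequence s then approximates the L^2 limit f in the sense of [approx], which puts f in the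
    domain, and s carries u to f. *)
Lemma graph_complete : ip_complete cdom (graph_ip l).
Proof.
move=> u du cu; have Lu n : L2 (u n) by case: (du n).
have cuP := (ip_cauchyP graph_semi_inner du).1 cu.
have sl : 0 < Num.sqrt l by rewrite sqrtr_gt0.
have cu2 : ip_cauchy inner u.
  apply/(ip_cauchyP sp2) => // e e0.
  have [N hN] := cuP _ (mulr_gt0 sl e0); exists N => m n Nm Nn.
  rewrite -(ltr_pM2l sl); apply: le_lt_trans (hN m n Nm Nn).
  by apply: inner_norm_le; exact: (sipB cval_semi_inner).
have [f Lf uf] := L2_complete Lu cu2.
have /choice[s hs] : forall n : nat, exists s, [/\ Sm s,
    ip_norm cval (s - u n) < n.+1%:R^-1 & ip_norm inner (s - u n) < n.+1%:R^-1].
  move=> n; have [_ [s hs]] := du n; have [Ss su _] := hs.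
  have i0 : 0 < n.+1%:R^-1 :> R by rewrite invr_gt0.
  have [N1 hN1] := (ip_cvgP _ _).1 (approx_cvg (Lu n) hs) _ i0.
  have [N2 hN2] := (ip_cvgP _ _).1 su _ i0.
  exists (s (maxn N1 N2)); split=> //; [apply: hN1|apply: hN2].
    exact: leq_maxl.
  exact: leq_maxr.
have Ss n : Sm (s n) by case: (hs n).
have ds n : cdom (s n) by exact: cdom_smooth.
have hs1 n : ip_norm cval (s n - u n) < n.+1%:R^-1 by case: (hs n).
have hs2 n : ip_norm inner (s n - u n) < n.+1%:R^-1 by case: (hs n).
have spc := cval_semi_inner.
have sf : ip_cvg inner s f.
  apply/ip_cvgP => e e0; have e2 : 0 < e / 2 by lra.
  have [N1 hN1] := (ip_cvgP _ _).1 uf _ e2; have [N2 hN2] := invn_lt e2.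
  exists (maxn N1 N2) => n; rewrite geq_max => /andP[/hN1 h1 /hN2 h2].
  have -> : s n - f = (s n - u n) + (u n - f) by rewrite addrA subrK.
  have Ls := Sm_L2 (Ss n).
  apply: le_lt_trans (nrmD_le sp2 (sipB sp2 Ls (Lu n)) (sipB sp2 (Lu n) Lf)) _.
  have := hs2 n; move: (n.+1%:R^-1) h2 => r; lra.
have cs : ip_cauchy D0 s.
  apply/(ip_cauchyP spS) => // e e0; have e3 : 0 < e / 3 by lra.
  have [N1 hN1] := cuP _ e3; have [N2 hN2] := invn_lt e3.
  exists (maxn N1 N2) => m n; rewrite !geq_max => /andP[m1 m2] /andP[n1 n2].
  have -> : ip_norm D0 (s m - s n) = ip_norm cval (s m - s n).
    by rewrite /ip_norm cval_smooth//; exact: (sipB spS).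
  have -> : s m - s n = (s m - u m) + ((u m - u n) - (s n - u n)).
    by rewrite opprB [X in _ = _ + X]addrA subrK addrA subrK.
  have d1 := sipB spc (ds m) (du m); have d2 := sipB spc (du m) (du n).
  have d3 := sipB spc (ds n) (du n).
  apply: le_lt_trans (nrmD_le spc d1 (sipB spc d2 d3)) _.
  have := nrmD_le spc d2 (sipN spc d3); rewrite (nrmN spc)//.
  have := hs1 m; have := hs1 n; have := hN2 _ m2; have := hN2 _ n2.
  have := hN1 _ _ m1 n1; have := cval_norm_le d2.
  by move: (m.+1%:R^-1) (n.+1%:R^-1) => r1 r2; lra.
have df : cdom f by split=> //; exists s.
exists f => //; apply: graph_cvg => //.
apply/ip_cvgP => e e0; have e2 : 0 < e / 2 by lra.
have [N1 hN1] := (ip_cvgP _ _).1 (approx_cvg Lf (And3 Ss sf cs)) _ e2.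
have [N2 hN2] := invn_lt e2.
exists (maxn N1 N2) => n; rewrite geq_max => /andP[/hN1 h1 /hN2 h2].
have -> : u n - f = (s n - f) - (s n - u n).
  by rewrite opprB [RHS]addrC addrA subrK.
have d1 := sipB spc (ds n) (du n); have d2 := sipB spc (ds n) df.
apply: le_lt_trans (nrmD_le spc d2 (sipN spc d1)) _.
by rewrite (nrmN spc)//; have := hs1 n; move: (n.+1%:R^-1) h2 => r; lra.
Qed.

End GraphNorm.
End FormClosure.

(** * Orthogonal expansions and Sobolev spaces *)

Section OrthogonalSums.
Context {R : realType} {V : lmodType R} {H : set V} {ip : V -> V -> R}.
Hypothesis sp : semi_inner H ip.

Definition lin_sum (x : nat -> V) (a : nat -> R) (m n : nat) : V :=
  \sum_(m <= k < n) a k *: x k.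

Lemma lin_sum_mem x a m n : (forall k, H (x k)) -> H (lin_sum x a m n).
Proof.
move=> Hx; apply: big_ind => //; first exact: (sip0 sp).
- by move=> y z Hy Hz; exact: (sipD sp).
- by move=> k _; exact: (sipZ sp).
Qed.

Lemma ip_lin_suml x a m n y : (forall k, H (x k)) -> H y ->
  ip (lin_sum x a m n) y = \sum_(m <= k < n) a k * ip (x k) y.
Proof.
move=> Hx Hy; rewrite /lin_sum; elim: (index_iota m n) => [|k s ih].
  by rewrite !big_nil (ip0l sp).
rewrite !big_cons (sipL sp) ?ih//; apply: big_ind => //; first exact: (sip0 sp).
- by move=> u v Hu Hv; exact: (sipD sp).
- by move=> i _; exact: (sipZ sp).
Qed.

Context {x : nat -> V} {w : nat -> R}.
Hypothesis Hx : forall k, H (x k).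
Hypothesis x_orth : forall j k, ip (x j) (x k) = w k * (j == k)%:R.

Lemma ip_lin_sum_orth a m n j :
  ip (lin_sum x a m n) (x j) = if (m <= j < n)%N then a j * w j else 0.
Proof.
rewrite ip_lin_suml//; under eq_bigr do rewrite x_orth.
case: ifPn => mjn.
  rewrite (bigD1_seq j) ?mem_index_iota ?iota_uniq//= eqxx mulr1.
  rewrite big1 ?addr0// => i /negbTE ->.
  by rewrite !mulr0.
rewrite big_nat_cond big1// => i /andP[min _].
have [ij|] := eqVneq i j; last by rewrite !mulr0.
by move: mjn; rewrite -ij min.
Qed.

Lemma ip_lin_sum_sqr a m n :
  ip (lin_sum x a m n) (lin_sum x a m n) = \sum_(m <= k < n) w k * a k ^+ 2.
Proof.
have Hs := lin_sum_mem a m n Hx.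
rewrite {1}/lin_sum ip_lin_suml//; apply: eq_big_nat => k mkn.
by rewrite (sipC sp)// ip_lin_sum_orth mkn expr2; ring.
Qed.

Lemma bessel a m n f : H f -> (forall k, ip f (x k) = w k * a k) ->
  \sum_(m <= k < n) w k * a k ^+ 2 <= ip f f.
Proof.
move=> Hf fx; have Hs := lin_sum_mem a m n Hx.
have := sip_ge0 sp (sipB sp Hf Hs).
have Hfs := sipB sp Hf Hs.
rewrite (ipBl sp)// !(ipBr sp)// ip_lin_sum_sqr (sipC sp Hf Hs).
rewrite {1 2}/lin_sum !ip_lin_suml//.
have -> : \sum_(m <= k < n) a k * ip (x k) f =
    \sum_(m <= k < n) w k * a k ^+ 2.
  by apply: eq_bigr => k _; rewrite (sipC sp)// fx expr2; ring.
by lra.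
Qed.

End OrthogonalSums.

Lemma cvgn_eq (R : realType) (u v : nat -> R) : u =1 v -> cvgn u -> cvgn v.
Proof. by move=> /funext ->. Qed.

Lemma nonneg_series_cvg (R : realType) (a : nat -> R) (C : R) :
  (forall k, 0 <= a k) ->
  (forall n, \sum_(1 <= k < n) a k <= C) -> cvgn (fun n => \sum_(1 <= k < n) a k).
Proof.
move=> a0 aC; apply: nondecreasing_is_cvgn; last first.
  by exists C => _ [n _ <-]; exact: aC.
apply/nondecreasing_seqP => -[|n]; first by rewrite !big_geq.
by rewrite [leRHS]big_nat_recr//= lerDl.
Qed.

Lemma nonneg_series_bounded (R : realType) (a : nat -> R) :
  (forall k, 0 <= a k) -> cvgn (fun n => \sum_(1 <= k < n) a k) ->
  exists C, forall n, \sum_(1 <= k < n) a k <= C.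
Proof.
move=> a0 ac; exists (limn (fun n => \sum_(1 <= k < n) a k)) => n.
apply: (nondecreasing_cvgn_le (u_ := fun n => \sum_(1 <= k < n) a k)) => //.
apply/nondecreasing_seqP => -[|m]; first by rewrite !big_geq.
by rewrite [leRHS]big_nat_recr//= lerDl.
Qed.

(** * Spectral description of H^1 and H^2 *)

Section Spectral.
Context {R : realType} {V : lmodType R} {L2 : set V} {inner : V -> V -> R}.
Context {Sm : set V} {D0 : V -> V -> R}.
Hypothesis sp2 : semi_inner L2 inner.
Hypothesis L2_complete : ip_complete L2 inner.
Hypothesis spS : semi_inner Sm D0.
Hypothesis Sm_L2 : Sm `<=` L2.
Hypothesis D0_op : forall h, Sm h -> exists2 k, L2 k &
  forall s, Sm s -> D0 s h = - inner s k.
Local Notation cdom := (@cdom R V L2 inner Sm D0).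
Local Notation cval := (@cval R V inner Sm D0).
Local Notation graph_ip := (@graph_ip R V inner Sm D0).
Let spc : semi_inner cdom cval := cval_semi_inner sp2 spS Sm_L2 D0_op.

Variables (lam : nat -> R) (phi : nat -> V).
Hypothesis lam0 : lam 0%N = 0.
Hypothesis lam1 : 0 < lam 1%N.
Hypothesis lam_mono : {homo lam : m n / (m <= n)%N >-> m <= n}.
Hypothesis phi_dom : forall k, cdom (phi k).
Hypothesis phi_weak : forall k h, Sm h ->
  cval (phi k) h = lam k * inner (phi k) h.
Hypothesis phi_orth : forall m n, inner (phi m) (phi n) = (m == n)%:R.
Hypothesis phi_total : forall f, L2 f ->
  ip_cvg inner (lin_sum phi (fun k => inner f (phi k)) 0) f.

Definition sob (m : nat) (f : V) : Prop :=
  L2 f /\ exists a : nat -> R,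
    ip_cvg inner (lin_sum phi a 1) f /\
    cvgn (fun n : nat => \sum_(1 <= k < n) `|a k| ^+ 2 * lam k ^+ m).

(** H^1 seen through the form: its domain, without the component along constants. *)
Definition sob1 : set V := [set f | cdom f /\ inner f (phi 0%N) = 0].

Let phiL k : L2 (phi k). Proof. by case: (phi_dom k). Qed.

Let lam_gt0 k : (0 < k)%N -> 0 < lam k.
Proof. by move=> k0; exact: lt_le_trans lam1 (lam_mono k0). Qed.

Let lam_ge0 k : 0 <= lam k.
Proof. by case: k => [|k]; [rewrite lam0|exact/ltW/lam_gt0]. Qed.

Let phi_orth2 j k : inner (phi j) (phi k) = (fun=> 1) k * (j == k)%:R.
Proof. by rewrite phi_orth mul1r. Qed.

Lemma cval_phi k h : cdom h -> cval (phi k) h = lam k * inner (phi k) h.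
Proof.
move=> dh; have Lk := sipZ sp2 (- lam k) (phiL k).
have := weak_cval sp2 spS Sm_L2 D0_op (phi_dom k) Lk.
move=> ->//; first by rewrite (ipZl sp2)//; [ring|case: dh].
by move=> s Ss; rewrite (ipZl sp2) ?phi_weak//; [ring|exact: Sm_L2].
Qed.

Let phi_orthD j k : cval (phi j) (phi k) = lam k * (j == k)%:R.
Proof.
rewrite cval_phi// phi_orth; have [->//|] := eqVneq j k.
by rewrite !mulr0.
Qed.

(** The coefficients are forced: pairing the partial sums with [phi j] gives an eventually constant
    sequence. The sums start at 1, hence the value 0 at j = 0. *)
Lemma sum_coef a f j : L2 f -> ip_cvg inner (lin_sum phi a 1) f ->
  inner f (phi j) = if (0 < j)%N then a j else 0.
Proof.
move=> Lf af; have Ls n : L2 (lin_sum phi a 1 n) by exact: (lin_sum_mem sp2).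
apply: (seq_lim_unique (ip_cvgl sp2 Ls Lf (phiL j) af)).
apply/cvg_seqP => e e0; exists j.+1 => n jn.
rewrite (ip_lin_sum_orth sp2 phiL phi_orth2) jn andbT mulr1.
by case: ifP; rewrite subrr normr0.
Qed.

Lemma sob_L2 m f : sob m f -> L2 f /\ inner f (phi 0%N) = 0.
Proof. by move=> [Lf [a [af _]]]; split => //; rewrite (sum_coef 0 Lf af). Qed.

(** The unknown coefficients are the Fourier ones, and a series of nonnegative terms converges
    exactly when it is bounded; bounds are what Bessel's inequality supplies. *)
Lemma sobP m f : sob m f <-> [/\ L2 f, inner f (phi 0%N) = 0 &
  exists C, forall n, \sum_(1 <= k < n) lam k ^+ m * inner f (phi k) ^+ 2 <= C].
Proof.
have t0 k : 0 <= lam k ^+ m * inner f (phi k) ^+ 2.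
  by rewrite mulr_ge0 ?sqr_ge0// exprn_ge0.
split=> [[Lf [a [af ac]]]|[Lf f0 [C hC]]].
  split=> //; first by rewrite (sum_coef 0 Lf af).
  apply: nonneg_series_bounded => //.
  move: ac; apply: cvgn_eq => n; apply: eq_big_nat => k /andP[k0 _].
  by rewrite (sum_coef k Lf af) k0 real_normK ?num_real// mulrC.
split=> //; exists (fun k => inner f (phi k)); split; last first.
  have := nonneg_series_cvg t0 hC.
  apply: cvgn_eq => n; apply: eq_bigr => k _.
  by rewrite real_normK ?num_real// mulrC.
have := phi_total Lf => /ip_cvgP h; apply/ip_cvgP => e /h[N hN].
(* For a nonempty range of indices the term k = 0 splits off, and it vanishes. *)
exists N.+1 => -[//|n] Nn; have := hN n.+1 (ltnW Nn).
by rewrite /lin_sum big_nat_recl//= f0 scale0r add0r big_add1.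
Qed.

(** The [phi k] are orthogonal for the form too, with squares [lam k]. Bessel's inequality for the
    form bounds the coefficients; conversely, summability makes the partial sums Cauchy for the
    graph norm, and completeness puts their limit in the domain. *)
Lemma sob1P f : sob 1 f <-> sob1 f.
Proof.
split=> [[Lf [a [af ac]]]|[df f0]]; last first.
  have [Lf _] := df; apply/sobP; split=> //; exists (cval f f) => n.
  under eq_bigr do rewrite expr1.
  apply: (bessel spc phi_dom phi_orthD) => // k.
  by rewrite (sipC spc)// cval_phi// (sipC sp2).
split; last by rewrite (sum_coef 0 Lf af).
pose p := lin_sum phi a 1.
have dp n : cdom (p n) by exact: (lin_sum_mem spc).
have Lp n : L2 (p n) by case: (dp n).
pose S n := \sum_(1 <= k < n) lam k * a k ^+ 2.
have pS m n : (0 < m)%N -> (m <= n)%N ->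
    cval (p n - p m) (p n - p m) = S n - S m.
  move=> m0 mn; rewrite /p /lin_sum (big_cat_nat m0 mn)/= addrAC subrr add0r.
  rewrite -[X in cval X]/(lin_sum phi a m n) (ip_lin_sum_sqr spc phi_dom phi_orthD).
  by rewrite /S (big_cat_nat m0 mn)/= addrAC subrr add0r.
have cS : cvgn S.
  move: ac; apply: cvgn_eq => n; apply: eq_bigr => k _.
  by rewrite expr1 real_normK ?num_real// mulrC.
have cp : ip_cauchy cval p.
  move=> e e0; have e2 : 0 < e / 2 by lra.
  have /cvg_ex[s /cvg_seqP/(_ _ e2)[N hN]] := cS.
  have key m n : (N.+1 <= m)%N -> (m <= n)%N ->
      cval (p n - p m) (p n - p m) < e.
    move=> Nm mn; rewrite pS//; last exact: leq_ltn_trans Nm.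
    have := hN n (leq_trans (ltnW Nm) mn); have := hN m (ltnW Nm).
    by rewrite -/(S n) -/(S m) !ltr_norml; lra.
  exists N.+1 => m n Nm Nn; have [mn|/ltnW nm] := leqP m n; last exact: key.
  rewrite -[p m - p n]opprB (ipNl spc) ?(ipNr spc) ?opprK; first exact: key.
  - exact: (sipB spc).
  - exact: (sipB spc).
  - exact: (sipB spc).
  - by apply: (sipN spc); exact: (sipB spc).
have cp2 := ip_cvg_cauchy sp2 Lp Lf af.
have cg : ip_cauchy (graph_ip 1) p.
  move=> e e0; have e2 : 0 < e / 2 by lra.
  have [N hN] := cp _ e2; have [N' hN'] := cp2 _ e2.
  exists (maxn N N') => m n; rewrite !geq_max => /andP[m1 m2] /andP[n1 n2].
  by have := hN _ _ m1 n1; have := hN' _ _ m2 n2; rewrite /graph_ip; lra.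
have [f' df' pf'] := graph_complete sp2 L2_complete spS Sm_L2 D0_op ltr01 dp cg.
have [Lf' _] := df'.
(* Both f' and f are L^2 limits of p, so they differ by a null function only. *)
apply: (cdom_eq sp2 Sm_L2 df') => //; apply/eqP; rewrite eq_le nrm_ge0 andbT.
apply/ler_addgt0Pr => e e0; rewrite add0r.
have e2 : 0 < e / 2 by lra.
have [N hN] := (ip_cvgP _ _).1 pf' _ e2; have [N' hN'] := (ip_cvgP _ _).1 af _ e2.
have := hN _ (leq_maxl N N'); have := hN' _ (leq_maxr N N').
rewrite -/p; move: (maxn N N') => n.
have := inner_norm_le sp2 spS Sm_L2 D0_op ltr01 (sipB spc (dp n) df').
rewrite sqrtr1 mul1r.
have -> : f' - f = (p n - f) - (p n - f').
  by rewrite opprB [RHS]addrC addrA subrK.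
have := nrmD_le sp2 (sipB sp2 (Lp n) Lf) (sipN sp2 (sipB sp2 (Lp n) Lf')).
by rewrite (nrmN sp2); [lra|exact: (sipB sp2)].
Qed.

(** For k >= 1 the spectral gap gives lam k <= lam k ^ 2 / lam 1. *)
Lemma sob2_sob1 f : sob 2 f -> sob1 f.
Proof.
move=> /sobP[Lf f0 [C hC]]; apply/sob1P/sobP; split=> //.
exists ((lam 1%N)^-1 * C) => n; apply: (@le_trans _ _ ((lam 1%N)^-1 *
  \sum_(1 <= k < n) lam k ^+ 2 * inner f (phi k) ^+ 2)); last first.
  by rewrite ler_pM2l ?invr_gt0.
rewrite mulr_sumr; apply: ler_sum_nat => k /andP[k0 _].
rewrite expr1 expr2 [leRHS]mulrA; apply: ler_wpM2r; first exact: sqr_ge0.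
by rewrite ler_pdivlMl//; apply: ler_wpM2r; rewrite ?lam_mono.
Qed.

Lemma sob1_lin a f h : sob1 f -> sob1 h -> sob1 (a *: f + h).
Proof.
move=> [df f0] [dh h0]; split; first exact: (sip_lin spc).
have [Lf _] := df; have [Lh _] := dh.
by rewrite (sipL sp2)// f0 h0 mulr0 addr0.
Qed.

Lemma sob1_proj f : cdom f -> sob1 (f - inner f (phi 0%N) *: phi 0%N).
Proof.
move=> df; have [Lf _] := df; have dp := sipZ spc (inner f (phi 0%N)) (phi_dom 0%N).
split; first exact: (sipB spc).
by rewrite (ipBl sp2)// ?(ipZl sp2)// ?phi_orth ?eqxx ?mulr1 ?subrr//; case: dp.
Qed.

Lemma sob1_phi k : (0 < k)%N -> sob1 (phi k).
Proof.
move=> k0; split; first exact: phi_dom.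
by rewrite phi_orth; case: k k0.
Qed.

Lemma sob1_semi_inner l : 0 < l -> semi_inner sob1 (graph_ip l).
Proof.
move=> l0; have spg := graph_semi_inner sp2 spS Sm_L2 D0_op l0; split.
- by split; [exact: (sip0 spc)|exact: (ip0l sp2)].
- exact: sob1_lin.
- by move=> x y [dx _] [dy _]; exact: (sipC spg).
- by move=> a x y z [dx _] [dy _] [dz _]; exact: (sipL spg).
- by move=> x [dx _]; exact: (sip_ge0 spg).
Qed.

(** Orthogonality to [phi 0] is an L^2-closed condition, and the graph norm controls the L^2 norm as
    l > 0. *)
Lemma sob1_complete l : 0 < l -> ip_complete sob1 (graph_ip l).
Proof.
move=> l0 u Hu cu; have du n : cdom (u n) by case: (Hu n).
have [f df uf] := graph_complete sp2 L2_complete spS Sm_L2 D0_op l0 du cu.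
exists f => //; split=> //.
have Lu n : L2 (u n) by case: (du n).
have [Lf _] := df.
have uf2 : ip_cvg inner u f.
  apply/ip_cvgP => e e0; have sl : 0 < Num.sqrt l by rewrite sqrtr_gt0.
  have [N hN] := (ip_cvgP _ _).1 uf _ (mulr_gt0 sl e0); exists N => n /hN h.
  rewrite -(ltr_pM2l sl); apply: le_lt_trans h.
  by apply: (inner_norm_le sp2 spS Sm_L2 D0_op l0); exact: (sipB spc).
apply: (seq_lim_unique (ip_cvgl sp2 Lu Lf (phiL 0%N) uf2)).
rewrite (_ : (fun n => inner (u n) (phi 0%N)) = cst 0); first exact: cvg_cst.
by apply/funext => n; case: (Hu n).
Qed.

(** Regularity by coefficients: testing with [phi k] gives lam k <f, phi k> = - <u, phi k>, so the
    H^2 sum is bounded by |u|^2. Tests with a component along [phi 0] are then allowed because that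
    component contributes 0 to both sides. *)
Lemma weak_sob2 f u : sob1 f -> L2 u -> inner u (phi 0%N) = 0 ->
    (forall h, sob1 h -> cval f h = - inner u h) ->
  sob 2 f /\ forall h, cdom h -> cval f h = - inner u h.
Proof.
move=> [df f0] Lu u0 fu; have [Lf _] := df; split.
  apply/sobP; split=> //; exists (inner u u) => n.
  rewrite (_ : \sum_(1 <= k < n) _ =
      \sum_(1 <= k < n) (fun=> 1) k * inner u (phi k) ^+ 2); last first.
    apply: eq_big_nat => k /andP[k0 _].
    rewrite mul1r -[inner u _]opprK -fu ?sqrrN; last exact: sob1_phi.
    by rewrite (sipC spc)// cval_phi// exprMn (sipC sp2).
  by apply: (bessel sp2 phiL phi_orth2) => // k; rewrite mul1r.
move=> h dh; have [Lh _] := dh.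
have := fu _ (sob1_proj dh); have L0 := sipZ sp2 (inner h (phi 0%N)) (phiL 0%N).
rewrite (ipBr spc)//; last exact: (sipZ spc).
rewrite (ipBr sp2)// (ipZr spc)// (ipZr sp2)// u0 (sipC spc df (phi_dom 0%N)).
by rewrite cval_phi// lam0 mul0r !mulr0 !subr0.
Qed.

(** All Fourier coefficients vanish, so u is the limit of zero partial sums. *)
Lemma sob0_null u : sob 0 u -> (forall h, sob1 h -> inner u h = 0) ->
  ip_norm inner u = 0.
Proof.
move=> /sob_L2[Lu u0] uh; apply/eqP; rewrite eq_le nrm_ge0 andbT.
apply/ler_addgt0Pr => e e0; rewrite add0r.
have [N hN] := (ip_cvgP _ _).1 (phi_total Lu) _ e0.
apply: ltW; have := hN N (leqnn N).
rewrite /lin_sum big1 ?sub0r ?(nrmN sp2)// => k _.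
by case: k => [|k]; [rewrite u0 scale0r|rewrite uh ?scale0r//; exact: sob1_phi].
Qed.

End Spectral.

(** * The space L^2 of a probability measure *)

Section SquareIntegrable.
Context d (T : measurableType d) (R : realType) (mu : probability T R).
Local Notation SqI := [set f : T -> R | f \in Lfun mu 2%:E].
Local Notation inn := (fun f h : T -> R => \int[mu]_x (f x * h x)).

Lemma Lfun2P (f : T -> R) : f \in Lfun mu 2%:E <->
  measurable_fun setT f /\ (\int[mu]_x (f x ^+ 2)%:E < +oo)%E.
Proof.
have sqE : (\int[mu]_x (f x ^+ 2)%:E = \int[mu]_x `|(EFin \o f) x| `^ 2)%E.
  apply: eq_integral => x _; rewrite /=.
  by rewrite powR_mulrn// real_normK ?num_real.
split=> [f2|[mf f2]].
  split; last by have /Lfun2_integrable_sqr/integrable_lty := f2; apply.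
  by move: f2; rewrite inE => /andP[]; rewrite inE.
rewrite inE; apply/andP; split; rewrite inE//=.
rewrite /finite_norm; apply: (@lty_poweRy _ _ 2) => //.
by rewrite powR_Lnorm// -sqE.
Qed.

Lemma Lfun2_measurable (f : T -> R) : f \in Lfun mu 2%:E -> measurable_fun setT f.
Proof. by move=> /Lfun2P[]. Qed.

Lemma Lfun2_integrable_mul (f h : T -> R) : f \in Lfun mu 2%:E -> h \in Lfun mu 2%:E ->
  mu.-integrable setT (EFin \o (fun x => f x * h x)).
Proof. by move=> f2 h2; apply/Lfun1_integrable; exact: Lfun2_mul_Lfun1. Qed.

Lemma Lfun2_semi_inner : semi_inner (V := T -> R) SqI inn.
Proof.
have le12 : (1 <= 2%:E :> \bar R)%E by rewrite lee_fin ler1n.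
split=> /=.
- have [h0 _] := Lfun_submod_closed mu le12; exact: h0.
- by move=> a f h f2 h2; have [_ ->] := Lfun_submod_closed mu le12.
- by move=> f h _ _; apply: eq_Rintegral => x _; rewrite mulrC.
- move=> a f h k f2 h2 k2; rewrite -RintegralZl//; last exact: Lfun2_integrable_mul.
  rewrite -RintegralD//.
  + by apply: eq_Rintegral => x _ /=; rewrite mulrDl -mulrA.
  + apply: (eq_integrable _ (fun x => a%:E * (f x * k x)%:E)%E) => //.
    by apply: integrableZl => //; exact: Lfun2_integrable_mul.
  + exact: Lfun2_integrable_mul.
- by move=> f f2; apply: Rintegral_ge0 => x _; rewrite -expr2 sqr_ge0.
Qed.

Lemma Lfun2_inner_sqr (f : T -> R) : f \in Lfun mu 2%:E ->
  (inn f f)%:E = (\int[mu]_x (f x ^+ 2)%:E)%E.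
Proof.
move=> f2; rewrite /Rintegral fineK.
  by apply: eq_integral => x _; rewrite expr2.
exact: integrable_fin_num (Lfun2_integrable_mul f2 f2).
Qed.

Lemma Lfun2_null (f : T -> R) : f \in Lfun mu 2%:E ->
  ip_norm (V := T -> R) inn f = 0 <-> ae_eq mu setT f (cst 0).
Proof.
move=> f2; have mf := Lfun2_measurable f2.
pose F x : \bar R := (f x ^+ 2)%:E.
have msq : measurable_fun setT F.
  by apply/measurable_EFinP; exact: measurable_funX.
have e0 : ip_norm (V := T -> R) inn f = 0 <-> (\int[mu]_x `|(f x ^+ 2)%:E| = 0)%E.
  rewrite (_ : (\int[mu]_x _ = _)%E = ((inn f f)%:E = 0%E)); last first.
    rewrite Lfun2_inner_sqr//; congr (_ = _); apply: eq_integral => x _.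
    by rewrite gee0_abs// lee_fin sqr_ge0.
  have i0 := sip_ge0 Lfun2_semi_inner f2.
  rewrite /ip_norm; split=> [/eqP|[->]]; last by rewrite sqrtr0.
  by rewrite sqrtr_eq0 => i1; congr EFin; apply/eqP; rewrite eq_le i1.
apply: (iff_trans e0); apply: (iff_trans (ae_eq_integral_abs mu measurableT msq)).
split; apply: filterS => x /= h _; move: (h I); rewrite /F.
  by move=> [] /eqP; rewrite sqrf_eq0 => /eqP.
by move=> ->; rewrite expr0n.
Qed.

End SquareIntegrable.

(** The modulus 2^-k makes the increments along [nu] summable. *)
Lemma fast_cauchy (R : realType) (V : lmodType R) (H : set V)
    (ip : V -> V -> R) (sp : semi_inner H ip) (u : nat -> V) :
    (forall n, H (u n)) -> ip_cauchy ip u ->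
  exists nu : nat -> nat, {homo nu : m n / (m <= n)%N} /\
    forall k m n, (nu k <= m)%N -> (nu k <= n)%N ->
      ip_norm ip (u m - u n) < 2^-1 ^+ k.
Proof.
move=> Hu /(ip_cauchyP sp Hu) cu.
have /choice[N hN] : forall k, exists N, forall m n, (N <= m)%N -> (N <= n)%N ->
    ip_norm ip (u m - u n) < 2^-1 ^+ k by move=> k; apply: cu; rewrite exprn_gt0.
(* Summing the thresholds makes [nu] monotone while keeping [nu k] above [N k]. *)
exists (fun k => \sum_(j < k.+1) N j)%N; split=> [m n mn|k m n km kn].
  rewrite -!(big_mkord xpredT N) [leqRHS](big_cat_nat (n := m.+1) (leq0n _))//=.
  exact: leq_addr.
by apply: hN; [apply: leq_trans km|apply: leq_trans kn];
  rewrite big_ord_recr/= leq_addl.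
Qed.

Lemma geometric_half_lty (R : realType) (a : nat -> \bar R) :
    (forall k, 0 <= a k)%E -> (forall k, a k <= (2^-1 ^+ k)%:E)%E ->
  (\sum_(0 <= k <oo) a k < +oo)%E.
Proof.
move=> a0 ak; apply: (@le_lt_trans _ _ 2%:E); last exact: ltry.
apply: lime_le; first exact: is_cvg_nneseries.
apply: nearW => n; apply: (@le_trans _ _ (\sum_(0 <= k < n) (2^-1 ^+ k)%:E)%E).
  by apply: lee_sum => k _; exact: ak.
rewrite sumEFin lee_fin.
have -> : \sum_(0 <= k < n) 2^-1 ^+ k = 2 - 2 * 2^-1 ^+ n :> R.
  elim: n => [|n ih]; first by rewrite big_geq// expr0 mulr1 subrr.
  by rewrite big_nat_recr//= ih exprS; field.
by rewrite gerBl mulr_ge0// exprn_ge0.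
Qed.

(** * Completeness of L^2 *)

Section RieszFischer.
Context d (T : measurableType d) (R : realType) (mu : probability T R).
Local Notation SqI := [set f : T -> R | f \in Lfun mu 2%:E].
Local Notation inn := (fun f h : T -> R => \int[mu]_x (f x * h x)).
Local Notation nrm := (ip_norm (V := T -> R) inn).
Let sp := Lfun2_semi_inner mu.

(** Cauchy-Schwarz against the constant 1, of norm 1 for a probability. It turns summable L^2 norms
    into summable integrals. *)
Lemma integral_norm_le (f : T -> R) : f \in Lfun mu 2%:E ->
  (\int[mu]_x `|f x|%:E <= (nrm f)%:E)%E.
Proof.
move=> f2; have [mf fy] := (Lfun2P mu f).1 f2.
have g2 : (fun x => `|f x|) \in Lfun mu 2%:E.
  apply/Lfun2P; split; first exact: measurableT_comp.
  by under eq_integral do rewrite real_normK ?num_real//.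
have one2 : cst 1 \in Lfun mu 2%:E.
  apply/Lfun2P; split => //.
  under eq_integral do rewrite expr1n.
  by rewrite integral_cst//= probability_setT mul1e ltry.
have nf : nrm (fun x => `|f x|) = nrm f.
  rewrite /ip_norm; congr (Num.sqrt _); apply: eq_Rintegral => x _.
  by rewrite -!expr2 real_normK ?num_real.
have n1 : nrm (cst 1) = 1.
  rewrite /ip_norm -[RHS]sqrtr1; congr (Num.sqrt _).
  rewrite (@eq_Rintegral _ _ _ mu setT (cst 1)); last by move=> x _; rewrite /= mulr1.
  rewrite Rintegral_cst//= [X in fine X](_ : _ = 1%E) ?mulr1//.
  exact: probability_setT.
have := cauchy_schwarz sp g2 one2; rewrite nf n1 mulr1 => cs.
rewrite (_ : (\int[mu]_x _ = (inn (fun x => `|f x|) (cst 1))%:E)%E).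
  by rewrite lee_fin; apply: le_trans cs; exact: ler_norm.
rewrite /Rintegral fineK; first by apply: eq_integral => x _; rewrite mulr1.
exact: integrable_fin_num (Lfun2_integrable_mul g2 one2).
Qed.

(** Fatou's lemma for the squares of w k - g off the null set N. It yields membership of f - g in
    L^2 together with the bound. *)
Lemma fatou_Lfun2 (N : set T) (w : nat -> T -> R) (f g : T -> R) (c : R) :
    measurable N -> mu N = 0%E -> measurable_fun setT f ->
    (forall x, ~ N x -> w k x @[k --> \oo] --> f x) ->
    (forall k, w k \in Lfun mu 2%:E) -> g \in Lfun mu 2%:E ->
    0 <= c -> (forall k, nrm (w k - g) <= c) ->
  (f : T -> R) - g \in Lfun mu 2%:E /\ nrm ((f : T -> R) - g) <= c.
Proof.
move=> mN N0 mf wf w2 g2 c0 wg.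
have mg := Lfun2_measurable g2.
have mfg : measurable_fun setT (f - g) by exact: measurable_funB.
have mD : measurable (setT `\` N) by exact: measurableD.
have int_le : (\int[mu]_x ((f - g) x ^+ 2)%:E <= (c ^+ 2)%:E)%E.
  rewrite (ge0_negligible_integral mN)//; last first.
  - by move=> x _; rewrite lee_fin sqr_ge0.
  - by apply/measurable_EFinP; exact: measurable_funX.
  pose F k x : \bar R := ((w k - g) x ^+ 2)%:E.
  have mF k : measurable_fun setT (F k).
    apply/measurable_EFinP; apply: measurable_funX.
    by apply: measurable_funB => //; exact: Lfun2_measurable.
  have F0 k x : (0 <= F k x)%E by rewrite lee_fin sqr_ge0.
  rewrite (eq_integral (fun x => limn_einf (F ^~ x))); last first.
    move=> x; rewrite inE => -[_ Nx]; apply/esym.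
    apply: (cvg_limn_einf_sup _).1; apply: cvg_EFin; first exact: nearW.
    rewrite [_ \o _](_ : _ = fun k => (w k x - g x) * (w k x - g x)); last first.
      by apply/funext => k; rewrite /= expr2.
    have wfg : w k x - g x @[k --> \oo] --> f x - g x.
      by apply: cvgB; [exact: wf|exact: cvg_cst].
    by rewrite expr2; exact: cvgM.
  apply: le_trans (fatou mu mD _ _) _ => //.
    by move=> k; exact: measurable_funTS.
  rewrite limn_einf_lim; apply: lime_le; first exact: is_cvg_einfs.
  apply: nearW => k; apply: (@le_trans _ _ (\int[mu]_(x in setT `\` N) F k x)%E).
    by apply: ereal_inf_lbound; exists k => /=.
  apply: (@le_trans _ _ (\int[mu]_x F k x)%E).
    by apply: ge0_subset_integral.
  have wg2 := sipB sp (w2 k) g2.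
  rewrite -(Lfun2_inner_sqr wg2) lee_fin -(nrm_sqr sp wg2).
  by rewrite ler_pXn2r// ?nnegrE ?nrm_ge0.
have fg2 : (f : T -> R) - g \in Lfun mu 2%:E.
  by apply/Lfun2P; split => //; exact: le_lt_trans int_le (ltry _).
split=> //; rewrite -(@ler_pXn2r _ 2)// ?nnegrE ?nrm_ge0// (nrm_sqr sp fg2).
by rewrite -lee_fin Lfun2_inner_sqr.
Qed.

(** Along the fast subsequence the sum [G] of absolute increments has finite integral, so it is
    finite off a null set, where the telescoping series converges. Fatou against each fixed [u n]
    then gives convergence of the whole sequence. *)
Lemma Lfun2_complete : ip_complete (V := T -> R) SqI inn.
Proof.
move=> u Hu cu; have [nu [nu_mono hnu]] := fast_cauchy sp Hu cu.
pose w k := u (nu k).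
have Hw k : w k \in Lfun mu 2%:E by exact: Hu.
have mw k := Lfun2_measurable (Hw k).
have Hv k : w k.+1 - w k \in Lfun mu 2%:E by exact: (sipB sp (Hw k.+1) (Hw k)).
have mv k := Lfun2_measurable (Hv k).
pose v k x : \bar R := `|(w k.+1 - w k) x|%:E.
have mv' k : measurable_fun setT (v k).
  by apply/measurable_EFinP; exact: measurableT_comp.
have v0 k x : (0 <= v k x)%E by rewrite lee_fin.
pose G x : \bar R := (\sum_(0 <= k <oo) v k x)%E.
have G0 x : (0 <= G x)%E by exact: nneseries_ge0.
have mG : measurable_fun setT G by exact: ge0_emeasurable_sum.
have Gy : (\int[mu]_x G x < +oo)%E.
  rewrite integral_nneseries//; apply: geometric_half_lty => k.
    exact: integral_ge0.
  apply: (le_trans (integral_norm_le (Hv k))); rewrite lee_fin ltW//.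
  by apply: hnu => //; exact: nu_mono.
have iG : mu.-integrable setT G.
  apply/integrableP; split=> //.
  by under eq_integral do rewrite gee0_abs//.
have [N [mN N0 hN]] := integrable_ae measurableT iG.
have wcvg x : ~ N x -> cvgn (w ^~ x).
  move=> Nx.
  have Gx : G x \is a fin_num.
    by apply: contrapT => h; apply: Nx; apply: hN => /= /(_ I).
  have : cvgn (series (telescope (w ^~ x))).
    apply: normed_cvg.
    have -> : [normed series (telescope (w ^~ x))] =
        (fun n => \sum_(0 <= k < n) `|w k.+1 x - w k x|).
      by apply/funext => n; rewrite /normed_series_of seriesEnat.
    apply: nondecreasing_is_cvgn.
      by apply/nondecreasing_seqP => n; rewrite [leRHS]big_nat_recr//= lerDl.
    exists (fine (G x)) => _ [n _ <-].
    rewrite -lee_fin fineK// -sumEFin.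
    exact: nneseries_lim_ge.
  rewrite telescopeK => h.
  rewrite (_ : w ^~ x = fun n => (w n x - w 0%N x) + w 0%N x).
    by apply: is_cvgD => //; exact: is_cvg_cst.
  by apply/funext => n; rewrite subrK.
(* On [N] the limit may not exist; a constant default value there keeps [f] measurable. *)
pose f : T -> R := (fun x => limn (w ^~ x)) \_ (~` N).
have mf : measurable_fun setT f.
  apply/measurable_restrict => //; first exact: measurableC.
  rewrite setTI; apply: (measurable_fun_cvg (h := w)).
    by move=> k; exact: measurable_funTS.
  by move=> x Nx; exact: wcvg.
have wf x : ~ N x -> w k x @[k --> \oo] --> f x.
  by move=> Nx; rewrite /f patchE mem_set//; exact: wcvg.
have key K n : (nu K <= n)%N ->
    f - u n \in Lfun mu 2%:E /\ nrm (f - u n) <= 2^-1 ^+ K.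
  (* The shift by K keeps all indices of the subsequence beyond [nu K]. *)
  move=> Kn; apply: (fatou_Lfun2 (w := fun k => w (k + K)%N) mN N0 mf) => //.
  - move=> x Nx; by have := wf x Nx; rewrite -(cvg_shiftn K).
  - exact: Hu.
  - by move=> k; apply/ltW/hnu => //; apply: nu_mono; exact: leq_addl.
have Hf : SqI f.
  have [h _] := key 0%N _ (leqnn _).
  by rewrite -[f](subrK (u (nu 0%N))); exact: (sipD sp h (Hu _)).
exists f => //; apply/ip_cvgP => e e0.
have [K hK] := invn_lt e0; exists (nu K) => n Kn.
rewrite (nrm_distC sp (Hu n) Hf); apply: le_lt_trans (hK K (leqnn K)).
apply: (le_trans (key K n Kn).2).
by rewrite exprVn lef_pV2 ?posrE ?exprn_gt0// -natrX ler_nat ltn_expl.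
Qed.

End RieszFischer.

(** * The Dirichlet form on smooth functions *)

(** On an open set, derivatives depend only on the values inside. This lets [Ck_lin] use derivation
    rules that hold at points of [W] alone. *)
Lemma Ck_eq (R : realType) (d n : nat) (W : set 'rV[R]_d) (f g : 'rV[R]_d -> R) :
  open W -> (forall u, W u -> f u = g u) -> Ck n W f -> Ck n W g.
Proof.
move=> oW; elim: n f g => [|n ih] f g fg [fc fd].
all: have near_fg u : W u -> \forall w \near u, f w = g w.
1,3: by move=> Wu; apply: filterS (open_nbhs_nbhs (conj oW Wu)).
all: have gc u : W u -> {for u, continuous g}.
1,3: by move=> Wu; rewrite /prop_for /continuous_at -fg//;
  exact: cvg_trans (near_eq_cvg (near_fg u Wu)) (fc u Wu).
  by split.
split=> // k.
have [fk fk'] := fd k; split=> [u Wu|].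
  exact: near_eq_derivable (near_fg u Wu) (fk u Wu).
apply: ih fk' => u Wu; exact: near_eq_derive (near_fg u Wu).
Qed.

Lemma Ck_lin (R : realType) (d n : nat) (W : set 'rV[R]_d) (a : R)
    (f g : 'rV[R]_d -> R) :
  open W -> Ck n W f -> Ck n W g -> Ck n W (a *: f + g).
Proof.
move=> oW; elim: n f g => [|n ih] f g [fc fd] [gc gd].
all: have afgc u : W u -> {for u, continuous (a *: f + g)}.
1,3: by move=> Wu; apply: cvgD (gc u Wu); apply: cvgM (fc u Wu); exact: cvg_cst.
  by split.
split=> // k.
have [fk fk'] := fd k; have [gk gk'] := gd k.
have afk u : W u -> derivable (a *: f) u (delta_mx ord0 k).
  by move=> Wu; apply: derivableZ; exact: fk.
split=> [u Wu|]; first by apply: derivableD; [exact: afk|exact: gk].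
apply: (Ck_eq oW _ (ih _ _ fk' gk')) => u Wu.
rewrite /partial deriveD; [|exact: afk|exact: gk].
by rewrite -[a *: f]/(a \*: f) deriveZ//; exact: fk.
Qed.

Section RiemannianForm.
Context {R : realType} {d : nat} {M : ptopologicalType} (S : riemannian R d M).
Variable pi : probability (borel M) R.

Lemma smooth_lin a f h : smooth S f -> smooth S h -> smooth S (a *: f + h).
Proof.
by move=> sf sh n i; apply: Ck_lin; [exact: open_image|exact: sf|exact: sh].
Qed.

Lemma dot_chart (x : M) : Defs.image (chart_at S x) (Defs.coord (chart_at S x) x).
Proof. by exists x => //; exact: dom_chart_at. Qed.

Lemma dotC (X Y : vfield S) x : dot X Y x = dot Y X x.
Proof.
have := Defs.metric_sym (dot_chart x); rewrite /dot.
move: (Defs.metric _ _) (X _ _) (Y _ _) => G v w Gt.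
have -> : v *m G *m w^T = (w *m G *m v^T)^T.
  by rewrite !trmx_mul trmxK Gt mulmxA.
by rewrite mxE.
Qed.

Lemma dot_ge0 (X : vfield S) x : 0 <= dot X X x.
Proof.
rewrite /dot; have [->|v0] := eqVneq (X (chart_at S x) (Defs.coord (chart_at S x) x)) 0.
  by rewrite !mul0mx mxE.
exact/ltW/(Defs.metric_pos (dot_chart x)).
Qed.

Lemma grad0 i u : grad S (0 : M -> R) i u = 0.
Proof.
rewrite /grad (_ : differential_row _ u = 0) ?mul0mx//.
by apply/rowP => k; rewrite !mxE /partial (_ : _ \o _ = cst 0)// derive_cst.
Qed.

Lemma dirichlet0C f h : dirichlet0 S pi f h = dirichlet0 S pi h f.
Proof. by apply: eq_Rintegral => x _; exact: dotC. Qed.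

Lemma dirichlet0_ge0 f : 0 <= dirichlet0 S pi f f.
Proof. by apply: Rintegral_ge0 => x _; exact: dot_ge0. Qed.

(** Computed directly: bilinearity of the form comes later, from Green's formula, whose proof uses
    this value. *)
Lemma dirichlet00 : dirichlet0 S pi 0 0 = 0.
Proof.
rewrite /dirichlet0 (@eq_Rintegral _ _ _ pi setT (cst 0)).
  by rewrite Rintegral_cst// mul0r.
by move=> x _; rewrite /dot !grad0 !mul0mx mxE.
Qed.

Lemma inner_semi_inner : semi_inner (V := M -> R) (L2 pi) (inner pi).
Proof. exact (Lfun2_semi_inner pi). Qed.

Lemma L2_complete : ip_complete (V := M -> R) (L2 pi) (inner pi).
Proof. exact (@Lfun2_complete _ _ _ pi). Qed.

Lemma eqL2P f h : L2 pi f -> L2 pi h ->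
  eqL2 pi f h <-> ip_norm (V := M -> R) (inner pi) (f - h) = 0.
Proof.
move=> Lf Lh; have L := sipB inner_semi_inner Lf Lh.
have := Lfun2_null (mu := pi) L => -[h1 h2]; split=> [fh|/h1].
  by apply: h2; apply: filterS fh => x /= fh /fh e; apply/eqP; rewrite subr_eq0 e.
by apply: filterS => x /= fh /fh /eqP; rewrite subr_eq0 => /eqP.
Qed.

Section Friedrichs.
Variables (U : M -> R) (A : @operator R M).
Hypothesis A_friedrichs : friedrichs_extension S pi U A.
Let sp2 := inner_semi_inner.

Lemma smooth_L2 : smooth S `<=` L2 pi.
Proof.
by move=> f sf; have [] := (A_friedrichs.2 _ _).1 (A_friedrichs.1 f sf) => -[].
Qed.

Let smooth_approx f : smooth S f -> form_approx S pi f (fun=> f).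
Proof.
move=> sf; split=> //; first exact: (ip_cvg_cst sp2 (smooth_L2 sf)).
by move=> e e0; exists 0%N => m n _ _; rewrite subrr dirichlet00.
Qed.

Lemma dirichlet0_green f h : smooth S f -> smooth S h ->
  dirichlet0 S pi f h = - inner pi (drift_laplacian S U f) h.
Proof.
move=> sf sh; have [_ _ fr] := (A_friedrichs.2 _ _).1 (A_friedrichs.1 f sf).
apply: (@seq_lim_unique _ (fun=> dirichlet0 S pi f h)); first exact: cvg_cst.
exact: fr (smooth_approx sf) (smooth_approx sh).
Qed.

Lemma drift_laplacian_L2 f : smooth S f -> L2 pi (drift_laplacian S U f).
Proof.
by move=> sf; have [] := (A_friedrichs.2 _ _).1 (A_friedrichs.1 f sf).
Qed.

Lemma dirichlet0_op h : smooth S h -> exists2 k, L2 pi k &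
  forall s, smooth S s -> dirichlet0 S pi s h = - inner pi s k.
Proof.
move=> sh; exists (drift_laplacian S U h); first exact: drift_laplacian_L2.
move=> s ss; rewrite dirichlet0C dirichlet0_green// (sipC sp2)//.
  exact: drift_laplacian_L2.
exact: smooth_L2.
Qed.

(** Linearity is inherited from the L^2 product through Green's formula, which replaces any
    discussion of the integrability of grad f . grad h. The given smooth function serves to make 0
    smooth. *)
Lemma dirichlet0_semi_inner : (exists f, smooth S f) ->
  semi_inner (V := M -> R) (smooth S) (dirichlet0 S pi).
Proof.
move=> [f0 sf0]; split.
- by have := smooth_lin (-1) sf0 sf0; rewrite scaleN1r addNr.
- exact: smooth_lin.
- by move=> f h _ _; exact: dirichlet0C.
- move=> a f h k sf sh sk; have safh := smooth_lin a sf sh.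
  have Lk := drift_laplacian_L2 sk.
  rewrite ![dirichlet0 _ _ _ k]dirichlet0C !dirichlet0_green//.
  have Lf := smooth_L2 sf; have Lh := smooth_L2 sh.
  rewrite (ipDr sp2)// ?(ipZr sp2)//; last exact: (sipZ sp2).
  by ring.
- by move=> f _; exact: dirichlet0_ge0.
Qed.

End Friedrichs.
End RiemannianForm.

(** * From the resolvent equations to the abstract skew equation *)

Theorem theorem1 (R : realType) (d : nat) (M : ptopologicalType)
    (M_compact : compact [set: M]) (M_hausdorff : hausdorff_space M)
    (S : riemannian R d M)
    (vol : {measure set (borel M) -> \bar R})
    (vol_riem : is_riemannian_volume S vol)
    (U : M -> R) (U_C1 : CkM S 1 U)
    (pi : probability (borel M) R)
    (pi_density : forall E : set (borel M), measurable E ->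
       pi E = (\int[vol]_(x in E) (expR (- U x))%:E)%E)
    (A : operator) (A_friedrichs : friedrichs_extension S pi U A)
    (lam : nat -> R) (phi : nat -> M -> R)
    (A_eigenbasis : eigenbasis pi A lam phi)
    (b : vfield S) (b_C1 : C1_vector_field b)
    (b_div : forall x, divergence (vscale (fun y => expR (- U y)) b) x = 0)
    (H1_sub_dom : forall f, sobolev pi lam phi 1 f -> transport_domain pi b f)
    (B : (M -> R) -> (M -> R))
    (B_ext : continuous_extension pi lam phi b B)
    (B_antisym : antisymmetric_on_H1 pi lam phi B)
    (g : M -> R) (g_in_H : sobolev pi lam phi 0 g)
    (l : R) (l_gt0 : 0 < l) :
  cvgH1_at_infinity S pi lam phi
    (fun c : R => resolvent pi A lam phi B c l g)
    (resolvent_star S pi A lam phi B l g).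
Proof.
have sp2 := inner_semi_inner pi; have L2c := @L2_complete R M pi.
have [[lam0 lam1 lam_mono _] phiP phi_orth phi_tot _] := A_eigenbasis.
have AE f u : A f u <-> [/\ cdom (V := M -> R) (L2 := L2 pi) (inner := inner pi)
      (Sm := smooth S) (D0 := dirichlet0 S pi) f, L2 pi u &
    forall h, smooth S h -> cform (V := M -> R) (inner := inner pi)
      (Sm := smooth S) (D0 := dirichlet0 S pi) f h (- inner pi u h)].
  exact: A_friedrichs.2.
(* Taken from a sequence approximating [phi 0] in the form domain. *)
have sm_ex : exists f, smooth S f.
  have [_ /AE[[_ [s [ss _ _]]] _ _]] := phiP 0%N.
  by exists (s 0%N).
have spS := dirichlet0_semi_inner A_friedrichs sm_ex.
have SmL := smooth_L2 A_friedrichs; have D0op := dirichlet0_op A_friedrichs.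
pose dom := cdom (V := M -> R) (L2 := L2 pi) (inner := inner pi)
  (Sm := smooth S) (D0 := dirichlet0 S pi).
have spc := cval_semi_inner sp2 spS SmL D0op.
(* This and the converse [weak_A] replace [A] by the weak equation tested on the whole form
   domain. *)
have A_weak f u : A f u -> forall h, dom h -> dirichlet S pi f h = - inner pi u h.
  move=> /AE[df Lu fu]; apply: (weak_cval sp2 spS SmL D0op df Lu) => h sh.
  by apply: (cval_eq sp2 spS SmL D0op df _ (fu h sh)); exact: cdom_smooth.
have weak_A f u : dom f -> L2 pi u ->
    (forall h, dom h -> dirichlet S pi f h = - inner pi u h) -> A f u.
  move=> df Lu fu; apply/AE; split=> // h sh.
  have dh : dom h by exact: (cdom_smooth sp2 spS SmL).
  by rewrite -fu//; exact: (cvalP sp2 spS SmL D0op df dh).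
have phi_dom k : dom (phi k) by have [_ /AE[]] := phiP k.
have phi_weak k h : smooth S h -> dirichlet S pi (phi k) h = lam k * inner pi (phi k) h.
  move=> sh; have [Lk Ak] := phiP k.
  rewrite (A_weak _ _ Ak); last exact: (cdom_smooth sp2 spS SmL).
  have := ipZl sp2 (- lam k) Lk (SmL _ sh) => e.
  by rewrite [inner _ _ _]e mulNr opprK.
have psE a m n : partial_sum phi a m n = lin_sum (V := M -> R) phi a m n.
  by apply/funext => x; rewrite /partial_sum /lin_sum fct_sumE.
have phi_total f : L2 pi f -> ip_cvg (V := M -> R) (inner pi)
    (lin_sum (V := M -> R) phi (fun k => inner pi f (phi k)) 0) f.
  by move=> Lf; have := phi_tot f Lf; rewrite (_ : partial_sum _ _ _ =
    lin_sum (V := M -> R) phi (fun k => inner pi f (phi k)) 0)//; exact/funext.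
have sobE m f : sobolev pi lam phi m f <->
    sob (V := M -> R) (L2 := L2 pi) (inner := inner pi) lam phi m f.
  rewrite /sobolev /sob; have psE1 a : partial_sum phi a 1 =
    lin_sum (V := M -> R) phi a 1 by exact/funext.
  by split=> -[Lf [a [h1 h2]]]; split=> //; exists a; split=> //;
    [rewrite -psE1|rewrite /cvgL2 psE1].
pose H := sob1 (V := M -> R) (L2 := L2 pi) (inner := inner pi) (Sm := smooth S)
  (D0 := dirichlet0 S pi) phi.
have HE f : sobolev pi lam phi 1 f <-> H f.
  apply: (iff_trans (sobE 1%N f)).
  exact: (sob1P sp2 L2c spS SmL D0op lam0 lam1 lam_mono phi_dom phi_weak phi_orth phi_total).
have sob2H f : sobolev pi lam phi 2 f -> H f.
  move=> /sobE; exact: (sob2_sob1 sp2 L2c spS SmL D0op lam0 lam1 lam_mono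
    phi_dom phi_weak phi_orth phi_total).
have sob_perp m f : sobolev pi lam phi m f -> L2 pi f /\ inner pi f (phi 0%N) = 0.
  by move=> /sobE; exact: (sob_L2 sp2 phi_dom phi_orth).
have Hdom f : H f -> dom f by case.
have HL f : H f -> L2 pi f by move=> /Hdom[].
have weak_H f u : H f -> L2 pi u -> inner pi u (phi 0%N) = 0 ->
    (forall h, H h -> dirichlet S pi f h = - inner pi u h) ->
    sobolev pi lam phi 2 f /\ A f u.
  move=> Hf Lu u0 fu.
  have [s2 fu'] := weak_sob2 sp2 spS SmL D0op lam0 lam1 lam_mono phi_dom phi_weak
    phi_orth phi_total Hf Lu u0 fu.
  by split; [exact/sobE|apply: weak_A => //; exact: Hdom].
have spH : semi_inner (V := M -> R) H (inner1 S pi l).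
  exact: (sob1_semi_inner sp2 spS SmL D0op phi_dom l_gt0).
have Hc : ip_complete (V := M -> R) H (inner1 S pi l).
  exact: (sob1_complete sp2 L2c spS SmL D0op phi_dom l_gt0).
have [B_sob B_lin [C BC] _] := B_ext.
have HB f : H f -> L2 pi (B f) /\ inner pi (B f) (phi 0%N) = 0.
  by move=> /HE /B_sob /sob_perp.
have eq_inner f f' h : L2 pi f -> L2 pi f' -> L2 pi h -> eqL2 pi f f' ->
    inner pi f h = inner pi f' h.
  move=> Lf Lf' Lh /(eqL2P Lf Lf') ff'; apply/eqP; rewrite -subr_eq0 -(ipBl sp2)//.
  by apply/eqP; apply: (nrm0_ip sp2) => //; exact: (sipB sp2).
(* [B] is linear only up to null functions, but pairing in L^2 does not see these, so [beta] is
   genuinely linear on H^1. *)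
pose beta f h := inner pi (B f) h.
have betaL a x y z : H x -> H y -> H z ->
    beta (a *: x + y) z = a * beta x z + beta y z.
  move=> Hx Hy Hz; have [Lx _] := HB _ Hx; have [Ly _] := HB _ Hy.
  have [Lxy _] := HB _ (sip_lin spH a Hx Hy).
  rewrite -(sipL sp2 a Lx Ly (HL _ Hz)); apply: eq_inner => //; [|exact: HL|].
    exact: (sip_lin sp2).
  by apply: B_lin; exact/HE.
have beta_skew x y : H x -> H y -> beta x y = - beta y x.
  move=> Hx Hy; rewrite /beta (sipC sp2 (HB _ Hx).1 (HL _ Hy)).
  rewrite (sipC sp2 (HB _ Hy).1 (HL _ Hx)).
  by apply: B_antisym; exact/HE.
have sl : 0 < Num.sqrt l by rewrite sqrtr_gt0.
(* |B x| is bounded through the H^1 part of the norm, and |y| through its l-weighted L^2 part,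
   whence 1 / sqrt l. [C] comes without a sign, hence its absolute value. *)
have beta_bounded x y : H x -> H y -> `|beta x y| <=
    (`|C| / Num.sqrt l) * ip_norm (V := M -> R) (inner1 S pi l) x *
    ip_norm (V := M -> R) (inner1 S pi l) y.
  move=> Hx Hy; apply: (le_trans (cauchy_schwarz sp2 (HB _ Hx).1 (HL _ Hy))).
  have hx := cval_norm_le sp2 spS SmL D0op l_gt0 (Hdom _ Hx).
  have hy := inner_norm_le sp2 spS SmL D0op l_gt0 (Hdom _ Hy).
  have -> s t : `|C| / Num.sqrt l * s * t = (`|C| * s) * ((Num.sqrt l)^-1 * t).
    by ring.
  apply: ler_pM; rewrite ?nrm_ge0//; last by rewrite ler_pdivlMl.
  apply: (le_trans (BC x ((HE x).2 Hx))).
  apply: (@le_trans _ _ (`|C| * normH1 S pi x)).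
    by apply: ler_wpM2r (ler_norm C); exact: sqrtr_ge0.
  by apply: ler_wpM2l hx.
have [Lg g0] := sob_perp _ _ g_in_H.
(* [f0] represents [- g], so that both resolvent equations become
   instances of [skew_solution _ f0]. *)
have [f0 Hf0 f0g] : exists2 f0, H f0 &
    forall h, H h -> inner1 S pi l f0 h = - inner pi g h.
  apply: (@riesz R (M -> R) H _ spH Hc (fun h => - inner pi g h)
    (normL2 pi g / Num.sqrt l)) => [a x y Hx Hy|x Hx].
    have Lx := HL _ Hx; have Ly := HL _ Hy.
    by rewrite (ipDr sp2 (sipZ sp2 a Lx) Ly Lg) (ipZr sp2 a Lg Lx); ring.
  rewrite normrN; apply: (le_trans (cauchy_schwarz sp2 Lg (HL _ Hx))).
  have hx := inner_norm_le sp2 spS SmL D0op l_gt0 (Hdom _ Hx).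
  by rewrite -mulrA; apply: ler_wpM2l; rewrite ?nrm_ge0// ler_pdivlMl.
pose sol c psi := skew_solution (V := M -> R) (H := H) (ip := inner1 S pi l) beta c f0 psi.
(* The function g + l psi - c B psi is what A psi must equal; its orthogonality to [phi 0] is
   required by [weak_H]. *)
have Lu c psi : H psi -> L2 pi (g + l *: psi - c *: B psi) /\
    inner pi (g + l *: psi - c *: B psi) (phi 0%N) = 0.
  move=> Hpsi; have Lpsi := HL _ Hpsi; have [LB B0] := HB _ Hpsi.
  have L1 := sipZ sp2 l Lpsi; have L2 := sipZ sp2 c LB; have L3 := sipD sp2 Lg L1.
  have [L4 _] := phiP 0%N; have [_ p0] := Hpsi.
  split; first exact: (sipB sp2).
  rewrite (ipBl sp2 L3 L2 L4) (ipDl sp2 Lg L1 L4) (ipZl sp2 _ Lpsi L4).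
  by rewrite (ipZl sp2 _ LB L4) g0 p0 B0 !mulr0 addr0 subr0.
have inner_u c psi h : H psi -> H h ->
    inner pi (g + l *: psi - c *: B psi) h =
    inner pi g h + l * inner pi psi h - c * beta psi h.
  move=> Hpsi Hh; have Lpsi := HL _ Hpsi; have [LB B0] := HB _ Hpsi.
  have L1 := sipZ sp2 l Lpsi; have L2 := sipZ sp2 c LB; have L3 := sipD sp2 Lg L1.
  have L4 := HL _ Hh.
  rewrite (ipBl sp2 L3 L2 L4) (ipDl sp2 Lg L1 L4) (ipZl sp2 _ Lpsi L4).
  by rewrite (ipZl sp2 _ LB L4).
(* A weak solution in H^1 is a strong one in H^2, by [weak_H]. *)
have sol_A c psi : sol c psi ->
    sobolev pi lam phi 2 psi /\ A psi (g + l *: psi - c *: B psi).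
  move=> [Hpsi hpsi]; have [L u0] := Lu c _ Hpsi.
  apply: weak_H => // h Hh; have := hpsi h Hh.
  by rewrite f0g// inner_u// /inner1; lra.
have A_sol c psi u : sobolev pi lam phi 2 psi -> A psi u ->
    eqL2 pi (g + l *: psi - c *: B psi) u -> sol c psi.
  move=> /sob2H Hpsi Au eu; split=> // h Hh; rewrite f0g//.
  have [_ L _] := (AE _ _).1 Au; have [L' _] := Lu c _ Hpsi.
  have := A_weak _ _ Au h (Hdom _ Hh).
  rewrite -(eq_inner _ _ h L' L (HL _ Hh) eu) inner_u// /inner1.
  by move=> ->; ring.
(* [skew_solvable] and [sol_A] provide a solution for [get] to select; [A_sol] turns the selected
   one back into a weak solution. *)
have xcP c : sol c (shift_inverse (perturbed pi A lam phi B c) l g).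
  have : perturbed pi A lam phi B c (shift_inverse (perturbed pi A lam phi B c) l g)
     (g + l *: shift_inverse (perturbed pi A lam phi B c) l g).
    apply: (@getPex _ [set psi : M -> R | perturbed pi A lam phi B c psi (g + l *: psi)]).
    have [psi spsi] := skew_solvable spH Hc betaL beta_skew beta_bounded c Hf0.
    have [s2 Apsi] := sol_A _ _ spsi.
    exists psi; split=> //; exists (g + l *: psi - c *: B psi) => //.
    by rewrite subrK; exact: ae_eq_refl.
  move: (shift_inverse _ _ _) => psi [s2 [u Au eu]].
  apply: (A_sol _ _ u s2 Au); apply: filterS eu => x /= ex /ex e.
  by apply/eqP; rewrite subr_eq e.
(* The unperturbed equation is the case c = 0. *)
have [psi0 psi0P psi0E] : exists2 psi0, sol 0 psi0 &
    psi0 = shift_inverse (restricted pi A lam phi) l g.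
  exists (shift_inverse (restricted pi A lam phi) l g) => //.
  have : restricted pi A lam phi (shift_inverse (restricted pi A lam phi) l g)
     (g + l *: shift_inverse (restricted pi A lam phi) l g).
    apply: (@getPex _ [set psi : M -> R | restricted pi A lam phi psi (g + l *: psi)]).
    have [psi spsi] := skew_solvable spH Hc betaL beta_skew beta_bounded 0 Hf0.
    have [s2 Apsi] := sol_A _ _ spsi; exists psi; split=> //.
    by move: Apsi; rewrite scale0r subr0.
  move: (shift_inverse _ _ _) => psi [s2 Au].
  by apply: (A_sol _ _ _ s2 Au); rewrite scale0r subr0; exact: ae_eq_refl.
have [Hpsi0 psi0f] := psi0P.
(* If [beta x] vanishes on H^1, then B x, which lies in H, is orthogonal to every [phi k] with k >=
   1, hence null. *)
have kerE x : kerB pi lam phi B x <-> skew_kernel (H := H) beta x.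
  split=> [[/HE Hx Bx]|[Hx Bx]].
    have [LB _] := HB _ Hx; have L0 := sip0 sp2.
    by split=> // h Hh; rewrite /beta (eq_inner _ 0 h LB L0 (HL _ Hh) Bx) (ip0l sp2)//; exact: HL.
  have sx := (HE x).2 Hx; split=> //.
  have [LB _] := HB _ Hx; apply/(eqL2P LB (sip0 sp2)); rewrite subr0.
  by apply: (sob0_null sp2 phi_dom phi_orth phi_total) => //; exact/sobE/B_sob.
have [p [Kp pP] pE] : exists2 p, skew_kernel (H := H) beta p /\
    (forall h, skew_kernel (H := H) beta h -> inner1 S pi l (psi0 - p) h = 0) &
    p = orth_proj (inner1 S pi l) (kerB pi lam phi B) psi0.
  exists (orth_proj (inner1 S pi l) (kerB pi lam phi B) psi0) => //.
  have [p Kp pP] := skew_kernel_proj spH Hc betaL beta_skew beta_bounded Hpsi0.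
  have := @getPex _ [set p : M -> R | kerB pi lam phi B p /\
    forall h, kerB pi lam phi B h -> inner1 S pi l (psi0 - p) h = 0].
  case=> [|K1 K2]; first by exists p; split; [exact/kerE|move=> h /kerE; exact: pP].
  by split; [exact/kerE|move=> h /kerE; exact: K2].
(* [psi0] solves the equation with c = 0, so it pairs with H^1 as [f0] does and can replace it as
   right-hand side. *)
have xc_sol c : skew_solution (V := M -> R) (H := H) (ip := inner1 S pi l) beta c psi0
    (shift_inverse (perturbed pi A lam phi B c) l g).
  have [Hx hx] := xcP c; split=> // h Hh; rewrite hx// -psi0f//.
  by rewrite mul0r subr0.
have := skew_solution_cvg spH Hc betaL beta_skew beta_bounded Hpsi0 Kp pP xc_sol.
rewrite /resolvent /resolvent_star -psi0E -pE => cvg_x.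
have Hp := Kp.1; split.
- by move=> c; apply/HE; apply: (sipN spH); exact: (xcP c).1.
- by apply/HE; exact: (sipN spH).
- move=> e /cvg_x[D hD]; exists D => c /hD; apply: le_lt_trans.
  have Hx := (xcP c).1; have Hxp := sipB spH Hx Hp.
  (* The minus signs of both resolvents factor out, and the norm of <.,.>_{1,l} dominates that of
     H^1. *)
  rewrite -opprD; apply: le_trans (cval_norm_le sp2 spS SmL D0op l_gt0 (Hdom _ Hxp)).
  by rewrite -(nrmN spc (Hdom _ Hxp)).
Qed.
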